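(* There is a universal (numerical) constant $c>0$ such that the following holds. Suppose the kernel $K$ has finite rank $r$, i.e. $\mu_j=0$ for all $j>r$. Suppose $f^*\in\mathcal H$ and $\mathbb E[(Y-f^*(x))^2\mid X=x]\le\sigma^2$ for $x\in\mathcal X$. Let $\bar f$ be the averaged divide-and-conquer kernel ridge regression estimate with $\lambda=r/N$, based on $N$ i.i.d. samples split into $m$ equal subsets. Suppose that either (i) for some $k>2$ there is $\rho<\infty$ with $\mathbb E[\phi_j(X)^{2k}]\le\rho^{2k}$ for all $j$, and $$m\le c\,\frac{N^{\frac{k-4}{k-2}}}{r^2\rho^{\frac{4k}{k-2}}\log^{\frac{k}{k-2}}r};$$ or (ii) there is $\rho<\infty$ with $\sup_{x\in\mathcal X}|\phi_j(x)|\le\rho$ for all $j$, and $$m\le c\,\frac{N}{r^2\rho^4\log N}.$$ Then, for suitably large $N$, the mean-squared error is bounded as $$\mathbb E\big[\|\bar f-f^*\|_2^2\big]=O(1)\,\frac{\sigma^2r}{N}.$$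
   Context: Setting. $(X,Y)$ is a random pair with values in $\mathcal X\times\mathbb R$ and joint distribution $\mathbb P$ (the marginal law of $X$ is also denoted $\mathbb P$); $f^*(x)=\mathbb E[Y\mid X=x]$; $\|g\|_2=(\int_{\mathcal X}g^2\,d\mathbb P)^{1/2}$. $K:\mathcal X\times\mathcal X\to\mathbb R$ is a symmetric positive semidefinite kernel with reproducing kernel Hilbert space $\mathcal H\subset L^2(\mathbb P)$ and norm $\|\cdot\|_{\mathcal H}$. It has the Mercer expansion $K(x,x')=\sum_{j\ge1}\mu_j\phi_j(x)\phi_j(x')$ with $\mu_1\ge\mu_2\ge\cdots\ge0$ and $\{\phi_j\}$ an orthonormal basis of $L^2(\mathbb P)$. Algorithm. Given $N$ i.i.d. samples $(x_i,y_i)$ from $\mathbb P$, divide them evenly and uniformly at random into $m$ disjoint subsets $S_1,\ldots,S_m$ of equal size $N/m$. For each $i$ compute $\hat f_i=\arg\min_{f\in\mathcal H}\big\{\frac1{|S_i|}\sum_{(x,y)\in S_i}(f(x)-y)^2+\lambda\|f\|_{\mathcal H}^2\big\}$, and output $\bar f=\frac1m\sum_{i=1}^m\hat f_i$. The expectation is over the samples (and the random partition). Convention. $O(1)$ is an asymptotic statement as $N\to\infty$ for a fixed problem (kernel, distribution, $f^*$, $\sigma$, $k$, $\rho$): the implied constant does not depend on $N$ or $m$.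
   Formalization: The formal theorem assumes σ > 0 (with σ = 0 the claimed error would be exactly 0, which regularization bias contradicts), r ≥ 1, and in case (i) r ≥ 2, since log r = 0 in the denominator makes the bound on m undefined at r = 1. *)

(* Defs.v *)
From HB Require Import structures.
From mathcomp Require Import all_boot all_order all_algebra.
From mathcomp Require Import all_classical all_reals all_analysis.

Set Implicit Arguments.
Unset Strict Implicit.
Unset Printing Implicit Defensive.

Import Order.TTheory GRing.Theory Num.Theory.
Import numFieldNormedType.Exports.

Local Open Scope classical_set_scope.
Local Open Scope ring_scope.

Section Fst.
Context (d1 d2 : measure_display)
  (T1 : measurableType d1) (T2 : measurableType d2).
HB.instance Definition _ :=
  isMeasurableFun.Build _ _ _ _ (fst : T1 * T2 -> T1) measurable_fst.
End Fst.

Section Law.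
Context (d : measure_display) (X : measurableType d) (R : realType).
Variable P : probability (X * R)%type R.

Definition marginal : probability X R :=
  distribution P (fst : {mfun (X * R)%type >-> X}).

(* [h] is a version of x |-> E[g(X,Y) | X = x]: both sides are integrable and
   have the same integral over every event {X \in A}. *)
Definition is_cond_exp (g : X * R -> R) (h : X -> R) : Prop :=
  [/\ P.-integrable setT (EFin \o g),
      marginal.-integrable setT (EFin \o h) &
      forall A : set X, measurable A ->
        (\int[P]_(z in A `*` setT) (g z)%:E =
         \int[marginal]_(x in A) (h x)%:E)%E].

End Law.

Definition orthonormal_basis (d : measure_display) (X : measurableType d)
    (R : realType) (Q : probability X R) (phi : nat -> X -> R) : Prop :=
  [/\ forall j, phi j \in Lfun Q 2%:E,
      forall i j, ('E_Q[fun x => (phi i x * phi j x)%R] = ((i == j)%:R)%:E)%E &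
      forall g : X -> R, g \in Lfun Q 2%:E -> forall e : R, 0 < e ->
        exists (n : nat) (a : nat -> R),
          (Lnorm Q 2%:E (EFin \o (g - \sum_(j < n) a j *: phi j)%R) < e%:E)%E].

Section RKHS.
Context (X : Type) (R : realType).
Variable K : X -> X -> R.

Definition psd_kernel : Prop :=
  (forall x y, K x y = K y x) /\
  (forall (n : nat) (x : 'I_n -> X) (a : 'I_n -> R),
     0 <= \sum_(i < n) \sum_(j < n) a i * a j * K (x i) (x j)).

(* [H] is the set of functions of the space, [ip] its inner product; the values
   of [ip] outside [H] are irrelevant. *)
Record is_rkhs (H : set (X -> R)) (ip : (X -> R) -> (X -> R) -> R) : Prop := {
  rkhs_zero : H 0 ;
  rkhs_closed : forall (a : R) f g, H f -> H g -> H (a *: f + g) ;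
  rkhs_sym : forall f g, H f -> H g -> ip f g = ip g f ;
  rkhs_linear : forall (a : R) f g h, H f -> H g -> H h ->
    ip (a *: f + g) h = a * ip f h + ip g h ;
  rkhs_ge0 : forall f, H f -> 0 <= ip f f ;
  rkhs_definite : forall f, H f -> ip f f = 0 -> f = 0 ;
  rkhs_complete : forall u : nat -> X -> R, (forall n, H (u n)) ->
    (forall e : R, 0 < e -> exists n0 : nat, forall p q : nat,
       (n0 <= p)%N -> (n0 <= q)%N -> Num.sqrt (ip (u p - u q) (u p - u q)) < e) ->
    exists2 f, H f &
      Num.sqrt (ip (u n - f) (u n - f)) @[n --> \oo] --> (0 : R) ;
  rkhs_kernel : forall x, H (K ^~ x) ;
  rkhs_reproducing : forall f x, H f -> ip f (K ^~ x) = f x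
}.

End RKHS.

(* Eigenpairs are indexed from 0. *)
Definition mercer (d : measure_display) (X : measurableType d) (R : realType)
    (Q : probability X R) (K : X -> X -> R)
    (mu : nat -> R) (phi : nat -> X -> R) : Prop :=
  [/\ forall i j, (i <= j)%N -> mu j <= mu i,
      forall j, 0 <= mu j,
      orthonormal_basis Q phi &
      forall x y, \sum_(j < n) mu j * phi j x * phi j y @[n --> \oo] --> K x y].

Section Split.
Context (N m : nat).

(* An ordered partition of the sample indices is coded by the map sending each
   index to the number of its block. *)
Definition block (s : {ffun 'I_N -> 'I_m}) (i : 'I_m) : {set 'I_N} :=
  [set j | s j == i]%SET.

Definition even_splits : {set {ffun 'I_N -> 'I_m}} :=
  [set s : {ffun 'I_N -> 'I_m} | [forall i, #|block s i| == N %/ m]%N]%SET.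

(* [Z] is an i.i.d. sample from [P]; [s] is a uniformly distributed even
   partition of the indices, independent of the sample. *)
Record is_split_sample (d dO : measure_display) (T : measurableType d)
    (Om : measurableType dO) (R : realType) (P : probability T R)
    (Pr : probability Om R) (Z : 'I_N -> Om -> T)
    (s : Om -> {ffun 'I_N -> 'I_m}) : Prop := {
  sample_measurable : forall j, measurable_fun setT (Z j) ;
  sample_iid : forall B : 'I_N -> set T, (forall j, measurable (B j)) ->
    Pr [set w | forall j, B j (Z j w)] = (\prod_(j < N) P (B j))%E ;
  split_measurable : forall t, measurable [set w | s w = t] ;
  split_uniform : forall t,
    Pr [set w | s w = t] =
      (if t \in even_splits then #|even_splits|%:R^-1 else 0)%:E ;
  split_independent : forall t (B : 'I_N -> set T),
    (forall j, measurable (B j)) ->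
    (Pr [set w | s w = t /\ forall j, B j (Z j w)] =
     Pr [set w | s w = t] * Pr [set w | forall j, B j (Z j w)])%E
}.

End Split.

Section KRR.
Context (X : Type) (R : realType).
Variables (H : set (X -> R)) (ip : (X -> R) -> (X -> R) -> R).

Definition krr_objective (lambda : R) (N : nat) (S : {set 'I_N})
    (z : 'I_N -> X * R) (f : X -> R) : R :=
  #|S|%:R^-1 * \sum_(j in S) (f (z j).1 - (z j).2) ^+ 2 + lambda * ip f f.

Definition is_krr_estimate (lambda : R) (N : nat) (S : {set 'I_N})
    (z : 'I_N -> X * R) (fhat : X -> R) : Prop :=
  H fhat /\
  forall g, H g -> krr_objective lambda S z fhat <= krr_objective lambda S z g.

End KRR.

(* Main.v *)
Require Import Defs.
From HB Require Import structures.
From mathcomp Require Import all_boot all_order all_algebra.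
From mathcomp Require Import all_classical all_reals all_analysis.
From mathcomp Require Import measurable_realfun ring lra.
Import Order.TTheory GRing.Theory Num.Theory.
Import numFieldNormedType.Exports HBNNSimple.
Local Open Scope classical_set_scope.
Local Open Scope ring_scope.
Set Implicit Arguments.
Unset Strict Implicit.

(** Why the bound holds.  Since the kernel has finite rank, every function of
    the RKHS is a combination of the first [q <= r] eigenfunctions, those with a
    positive eigenvalue ([rkhs_coordinates]), so each local estimate is a ridge
    regression in dimension [q].  With [f_k] the vector of features of the [k]-th
    design point, [eps_k] its noise, [n] the block size and
    [fstar = sum_l mu_l beta_l phi_l], the normal equations say that the
    coefficients [delta_i] of the error on block [i] satisfy
    [A_i delta_i = n^-1 sum_k eps_k f_k - lambda beta], where [A_i] is the
    empirical second moment matrix of the block plus [lambda diag(mu)^-1]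
    ([krr_error]).  By orthonormality the squared L2 error of the average is the
    squared length of the mean of the [delta_i] ([Lnorm2_orthonormal]).

    Noise part.  It equals [N^-1 sum_k eps_k a_k] with [a_k = A_i^-1 f_k] a
    function of the design alone.  The noise is centred given the design, so the
    cross terms vanish and the expected square is at most
    [sigma^2 N^-2 sum_k E |a_k|^2] ([integral_noise_sum_le]).  When the second
    moment matrix of the block is at least half the identity, [|a_k|^2] is at
    most [4 |f_k|^2], of mean at most [4 r]: this gives the main term
    [4 sigma^2 r / N].  In any case [|a_k|^2 <= kappa n / lambda], which grows
    only polynomially in [N].

    Bias part.  [lambda A_i^-1 beta] has length at most [2 lambda |beta|] on the
    good event, of order [1 / N], and is bounded by a constant otherwise.

    So it suffices that the bad event has probability [O(N^-2)].  Replace the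
    products [phi_l phi_l'] by weighted products bounded by some [b], with means
    within [1 / (4 r)] of those of the identity matrix; Chernoff's bound and a
    union bound over the entries give a probability at most
    [2 r^2 exp (- n / (512 r^2 b^2))] ([integral_bad_bound_le]).  For
    eigenfunctions bounded by [rho] the weight is 1 and [b = rho^2], and the
    condition on [m] says exactly that the exponent is at least [2 log N].  In
    the moment regime a level [b] exists by dominated convergence and depends only
    on the problem ([truncation_exists]); there the condition on [m] makes [n]
    grow at least like [N^(2 / (k - 2))], which dominates any multiple of
    [log N].

    All expectations are handled through one comparison principle
    ([le_integral_coordinate]): to compare the integrals of two nonnegative
    functions of an independent sample, it suffices to compare their integrals
    in a single coordinate, the others being frozen.  It is applied with the
    restriction of the probability to the event that the random split takes a
    given value; on that event the split is deterministic. *)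

(** * Functions of an independent sample, one coordinate at a time *)

(** Measurability of a function of [N] points, tested on all measurable families
    of points: this avoids putting a sigma-algebra on ['I_N -> T], and it is
    stable under freezing some of the coordinates. *)
Definition jointly_measurable {dT : measure_display} {T : measurableType dT}
    {R : realType} {N : nat} (F : ('I_N -> T) -> R) : Prop :=
  forall (d : measure_display) (S : measurableType d) (z : 'I_N -> S -> T),
    (forall k, measurable_fun setT (z k)) ->
    measurable_fun setT (fun w => F (fun k => z k w)).

Definition replace_coord {T : Type} {N : nat} (z : 'I_N -> T) (j : 'I_N) (x : T) :
  'I_N -> T := fun k => if k == j then x else z k.

(* [nu] need not have mass 1: it will be the restriction of a probability to the
   event that the random split takes a given value. *)
Section Comparison.
Context {dT dO : measure_display} {T : measurableType dT}
  {Om : measurableType dO} {R : realType} {N : nat}.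
Variables (P : probability T R) (nu : {finite_measure set Om -> \bar R})
  (Z : 'I_N -> Om -> T).
Hypothesis mZ : forall k, measurable_fun setT (Z k).
Hypothesis indepZ : forall B : 'I_N -> set T, (forall k, measurable (B k)) ->
  nu [set w | forall k, B k (Z k w)] = (nu setT * \prod_(k < N) P (B k))%E.

Section Coordinate.
Variable j : 'I_N.

(* The events depending on the coordinates other than [j] are generated by
   the pi-system of boxes unconstrained at [j]; [Om'] is [Om] with this smaller
   sigma-algebra. *)
Let rect : set (set Om) :=
  [set A | exists B : 'I_N -> set T, [/\ forall k, measurable (B k), B j = setT &
     A = [set w | forall k, B k (Z k w)]]].

Let Om' : measurableType rect.-sigma := g_sigma_algebraType rect.

Let rect_measurable : rect `<=` measurable.
Proof.
move=> _ [B [mB _ ->]].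
have -> : [set w | forall k, B k (Z k w)] = \bigcap_(k in setT) (Z k @^-1` B k).
  by apply/seteqP; split=> [w h k _|w h k]; [exact: h|exact: (h k)].
apply: fin_bigcap_measurable => // k _.
by rewrite -[X in measurable X]setTI; exact: mZ.
Qed.

Let rect_setI : setI_closed rect.
Proof.
move=> _ _ [B [mB Bj ->]] [C [mC Cj ->]].
exists (fun k => B k `&` C k); split => //.
- by move=> k; exact: measurableI.
- by rewrite Bj Cj setIT.
- apply/seteqP; split=> w; first by move=> [h1 h2] k; split.
  by move=> h; split=> k; case: (h k).
Qed.

Let rectT : rect setT.
Proof.
by exists (fun=> setT); split => //; apply/seteqP; split.
Qed.

Let toOm' (w : Om) : Om' := w.

Let mtoOm' : measurable_fun setT toOm'.
Proof.
move=> _ A mA; rewrite setTI /toOm' preimage_id.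
by apply: (smallest_sub (sigma_algebra_measurable Om) rect_measurable).
Qed.

Let mZ' k : k != j -> measurable_fun [set: Om'] (Z k : Om' -> T).
Proof.
move=> kj _ A mA; rewrite setTI; apply: sub_sigma_algebra.
exists (fun i => if i == k then A else setT); split.
- by move=> i; case: ifP.
- by rewrite eq_sym (negbTE kj).
- apply/seteqP; split=> w /=; last by move=> /(_ k); rewrite eqxx.
  by move=> h i; case: eqP => // ->.
Qed.

Let indep_coord (A : set T) (B : set Om) : measurable A -> <<s rect >> B ->
  nu (Z j @^-1` A `&` B) = (P A * nu B)%E.
Proof.
move=> mA; have mZA : measurable (Z j @^-1` A).
  by rewrite -[X in measurable X]setTI; exact: mZ.
have PA : (0 <= fine (P A))%R by rewrite fine_ge0.
have PAE : P A = (fine (P A))%:E by rewrite fineK// fin_num_measure.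
rewrite setIC PAE.
rewrite -[LHS]/(mrestr nu mZA B) -[RHS]/(mscale (NngNum PA) nu B).
move: B; apply: (@g_sigma_algebra_measure_unique _ _ _ rect _ (fun=> setT)
  _ _ (mrestr nu mZA) (mscale (NngNum PA) nu)) => //.
- by rewrite bigcup_const.
- move=> _ [B [mB Bj ->]]; rewrite -[LHS]/(nu (_ `&` _)) -[RHS]/((fine (P A))%:E * nu _)%E -PAE.
  have -> : [set w | forall k, B k (Z k w)] `&` Z j @^-1` A =
      [set w | forall k, (if k == j then A else B k) (Z k w)].
    apply/seteqP; split=> w /=.
      by move=> [h Aw] k; case: eqP => // ->.
    move=> h; split; last by have := h j; rewrite eqxx.
    by move=> k; have := h k; case: eqP => // -> _; rewrite Bj.
  rewrite (indepZ mB) (indepZ (B := fun k => if k == j then A else B k)); last first.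
    by move=> k; case: ifP.
  rewrite muleCA; congr (_ * _)%E.
  rewrite (bigD1 j)//= eqxx [in RHS](bigD1 j)//= Bj probability_setT mul1e.
  by congr (_ * _)%E; apply: eq_bigr => k /negbTE ->.
- move=> _; have : (nu (setT `&` Z j @^-1` A) < +oo)%E.
    by rewrite setTI ltey_eq fin_num_measure.
  exact.
Qed.

Let pairj (w : Om) : T * Om' := (Z j w, w).

Let mpairj : measurable_fun setT pairj.
Proof. by apply/measurable_fun_pairP; split => //=; exact: mZ. Qed.

(** The pair formed by coordinate [j] and the remaining information has law
    [P \x nu'] with [nu'] the restriction of [nu] to the sigma-algebra [Om'], so
    that Tonelli integrates coordinate [j] first. *)
Lemma le_integral_coordinate (F G : ('I_N -> T) -> R) :
  jointly_measurable F -> jointly_measurable G ->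
  (forall z, 0 <= F z) -> (forall z, 0 <= G z) ->
  (forall z, (\int[P]_x (F (replace_coord z j x))%:E <= \int[P]_x (G (replace_coord z j x))%:E)%E) ->
  (\int[nu]_w (F (fun k => Z k w))%:E <= \int[nu]_w (G (fun k => Z k w))%:E)%E.
Proof.
move=> mF mG F0 G0 FG.
pose nu0f : {measure set Om' -> \bar R} := pushforward nu toOm'.
pose nu0 := nu0f mtoOm'.
pose nuj : {measure set (T * Om') -> \bar R} := pushforward nu pairj.
have nu0_fin : fin_num_fun nu0.
  by move=> A mA; rewrite /= /pushforward fin_num_measure// -[X in measurable X]setTI; exact: mtoOm'.
pose nu' : {finite_measure set Om' -> \bar R} :=
  HB.pack (Measure.sort nu0) (Measure.class nu0) (Measure_isFinite.Build _ _ _ nu0 nu0_fin).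
have prodE (A : set (T * Om')) : measurable A ->
    (P \x nu')%E A = nuj mpairj A.
  apply: product_measure_unique => B C mB mC.
  exact: (indep_coord mB mC).
pose glue (p : T * Om') k := if k == j then p.1 else Z k p.2.
have mglue k : measurable_fun setT (fun p => glue p k).
  rewrite /glue; case: eqP => [_|/eqP kj]; first exact: measurable_fst.
  exact: measurableT_comp (mZ' kj) measurable_snd.
have main (H : ('I_N -> T) -> R) : jointly_measurable H -> (forall z, 0 <= H z) ->
    (\int[nu]_w (H (fun k => Z k w))%:E =
     \int[nu']_w \int[P]_x (H (replace_coord (fun k => Z k w) j x))%:E)%E.
  move=> mH H0.
  have mHg : measurable_fun setT (EFin \o (fun p : T * Om' => H (glue p))).
    by apply/measurable_EFinP; exact: mH.
  transitivity (\int[nu]_w ((fun p => (H (glue p))%:E) \o pairj) w)%E.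
    apply: eq_integral => w _ /=; congr (H _)%:E; apply/funext => k.
    by rewrite /glue /=; case: eqP => // ->.
  rewrite -[LHS](@ge0_integral_pushforward _ _ _ _ _ pairj mpairj nu setT)//.
  rewrite -(eq_measure_integral _ (fun A mA _ => prodE A mA)).
  rewrite fubini_tonelli2 //; first by move=> p; rewrite lee_fin.
  by move=> p _; rewrite lee_fin.
have mint (H : ('I_N -> T) -> R) : jointly_measurable H -> (forall z, 0 <= H z) ->
    measurable_fun [set: Om']
      (fun w => \int[P]_x (H (replace_coord (fun k => Z k w) j x))%:E)%E.
  move=> mH H0; apply: (@measurable_fun_fubini_tonelli_G _ _ T Om' R P
    (fun p => (H (glue p))%:E)).
    by apply/measurable_EFinP; exact: mH.
  by move=> p; rewrite lee_fin.
rewrite !main//; apply: ge0_le_integral => //.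
- by move=> w _; apply: integral_ge0 => x _; rewrite lee_fin.
- exact: mint.
- exact: mint.
Qed.
End Coordinate.
End Comparison.

Lemma bounded_integrable (d : measure_display) (T : measurableType d)
    (R : realType) (P : {finite_measure set T -> \bar R}) (f : T -> R) (b : R) :
  measurable_fun setT f -> (forall x, `|f x| <= b) ->
  P.-integrable setT (fun x => (f x)%:E).
Proof.
move=> mf fb; have b0 : 0 <= b by exact: le_trans (fb point).
apply: (@le_integrable _ _ _ _ _ measurableT _ (cst b%:E)) => //.
- exact/measurable_EFinP.
- by move=> z _ /=; rewrite lee_fin (ger0_norm b0).
- exact: finite_measure_integrable_cst.
Qed.

(** * Integrals against the noise *)

Section Weight.
Context {d d' : measure_display} {T : measurableType d} {X : measurableType d'}
  {R : realType}.
Variables (P : {measure set T -> \bar R}) (p : T -> X) (f1 f2 : T -> R).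
Hypotheses (mp : measurable_fun setT p)
  (mf1 : measurable_fun setT f1) (mf2 : measurable_fun setT f2)
  (f1_ge0 : forall z, 0 <= f1 z) (f2_ge0 : forall z, 0 <= f2 z).

Let range_nth_ge0 (h : {nnsfun X >-> R})
  (i : 'I_(size (finmap.enum_fset (fset_set (range h))))) :
  0 <= (finmap.enum_fset (fset_set (range h)))`_i.
Proof.
set s := finmap.enum_fset _; have : s`_i \in s by rewrite mem_nth.
by rewrite /s in_fset_set// inE => -[x _ <-].
Qed.

Let integral_weight_nnsfun (f : T -> R) (h : {nnsfun X >-> R}) :
  measurable_fun setT f -> (forall z, 0 <= f z) ->
  (\int[P]_z (f z * h (p z))%:E =
   let s := finmap.enum_fset (fset_set (range h)) in
   \sum_(i < size s)
     (s`_i)%:E * \int[P]_(z in p @^-1` (h @^-1` [set s`_i])) (f z)%:E)%E.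
Proof.
move=> mf f0.
have mph c : measurable (p @^-1` (h @^-1` [set c])).
  by rewrite -[X in measurable X]setTI; exact: mp.
cbv zeta; set s := finmap.enum_fset _.
have s0 (i : 'I_(size s)) : 0 <= s`_i by exact: range_nth_ge0.
under eq_integral => z _.
  rewrite fimfunEord mulr_sumr -sumEFin -/s; under eq_bigr do rewrite mulrCA EFinM.
  over.
rewrite ge0_integral_sum//=.
- apply: eq_bigr => i _; rewrite ge0_integralZl_EFin//=.
  + congr (_ * _)%E; rewrite [RHS]integral_mkcond; apply: eq_integral => z _.
    by rewrite epatch_indic /= EFinM.
  + by move=> z _; rewrite lee_fin mulr_ge0.
  + apply/measurable_EFinP; apply: measurable_funM => //.
    by apply: (measurableT_comp _ mp); exact: measurable_indic.
- move=> i; apply/measurable_EFinP; apply: measurable_funM => //.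
  apply: measurable_funM => //.
  by apply: (measurableT_comp _ mp); exact: measurable_indic.
- by move=> i z _; rewrite lee_fin !mulr_ge0.
Qed.

(** An inequality between the integrals over all events [p \in A] extends to all
    nonnegative weights depending on [p] only, by approximating the weight from
    below by simple functions.  This is how the defining property of a conditional
    expectation, which speaks of events, is used. *)
Lemma le_integral_weight (u : X -> R) :
  (forall A, measurable A ->
    (\int[P]_(z in p @^-1` A) (f1 z)%:E <= \int[P]_(z in p @^-1` A) (f2 z)%:E)%E) ->
  measurable_fun setT u -> (forall x, 0 <= u x) ->
  (\int[P]_z (f1 z * u (p z))%:E <= \int[P]_z (f2 z * u (p z))%:E)%E.
Proof.
move=> f12 mu u0.
have mEu : measurable_fun setT (EFin \o u) by exact/measurable_EFinP.
pose h := nnsfun_approx measurableT mEu.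
have Eu0 x : setT x -> (0 <= (EFin \o u) x)%E by rewrite /= lee_fin.
have cvgh (f : T -> R) : measurable_fun setT f -> (forall z, 0 <= f z) ->
    (\int[P]_z (f z * u (p z))%:E =
     limn (fun n => \int[P]_z (f z * h n (p z))%:E))%E.
  move=> mf f0.
  rewrite -monotone_convergence//.
  - apply: eq_integral => z _; apply/esym/cvg_lim => //.
    under eq_fun do rewrite EFinM.
    rewrite EFinM; apply: cvgeZl => //.
    exact: (cvg_nnsfun_approx measurableT mEu Eu0 (x := p z)).
  - move=> n; apply/measurable_EFinP; apply: measurable_funM => //.
    exact: measurableT_comp.
  - by move=> n z _; rewrite lee_fin mulr_ge0.
  - move=> z _ a b ab; rewrite lee_fin ler_wpM2l//.
    exact/lefP/nd_nnsfun_approx.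
rewrite !cvgh//; apply: lee_lim.
- apply: ereal_nondecreasing_is_cvgn => a b ab; apply: ge0_le_integral => //.
  + by move=> z _; rewrite lee_fin mulr_ge0.
  + by apply/measurable_EFinP; apply: measurable_funM => //; exact: measurableT_comp.
  + by apply/measurable_EFinP; apply: measurable_funM => //; exact: measurableT_comp.
  + move=> z _; rewrite lee_fin ler_wpM2l//; exact/lefP/nd_nnsfun_approx.
- apply: ereal_nondecreasing_is_cvgn => a b ab; apply: ge0_le_integral => //.
  + by move=> z _; rewrite lee_fin mulr_ge0.
  + by apply/measurable_EFinP; apply: measurable_funM => //; exact: measurableT_comp.
  + by apply/measurable_EFinP; apply: measurable_funM => //; exact: measurableT_comp.
  + move=> z _; rewrite lee_fin ler_wpM2l//; exact/lefP/nd_nnsfun_approx.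
- near=> n; rewrite !integral_weight_nnsfun//; apply: lee_sum => i _.
  by apply: lee_wpmul2l; [rewrite lee_fin; exact: range_nth_ge0|exact: f12].
Unshelve. all: by end_near. Qed.

End Weight.

Section Noise.
Context {d : measure_display} {X : measurableType d} {R : realType}.
Variables (P : probability (X * R)%type R) (fstar v : X -> R) (sigma : R).
Hypotheses (hmean : is_cond_exp P snd fstar)
  (hvar : is_cond_exp P (fun z => (z.2 - fstar z.1) ^+ 2) v)
  (hv : forall x, v x <= sigma ^+ 2).

Definition noise (f : X -> R) (z : X * R) : R := z.2 - f z.1.

Let eps := noise fstar.

Lemma ge0_integral_marginal (f : X -> R) : measurable_fun setT f ->
  (forall x, 0 <= f x) ->
  (\int[marginal P]_x (f x)%:E = \int[P]_z (f z.1)%:E)%E.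
Proof.
move=> mf f0.
rewrite /marginal /distribution ge0_integral_pushforward//.
- exact/measurable_EFinP.
- by move=> x _; rewrite lee_fin.
Qed.

Lemma integrable_marginal (f : X -> R) :
  (marginal P).-integrable setT (EFin \o f) ->
  P.-integrable setT (fun z => (f z.1)%:E).
Proof.
move=> /integrableP[/measurable_EFinP mf fi]; apply/integrableP; split.
  by apply/measurable_EFinP; exact: measurableT_comp.
rewrite -(@ge0_integral_marginal (fun x => `|f x|))//.
exact: measurableT_comp.
Qed.

Lemma integral_marginal (f : X -> R) (A : set X) : measurable A ->
  (marginal P).-integrable setT (EFin \o f) ->
  (\int[marginal P]_(x in A) (f x)%:E = \int[P]_(z in fst @^-1` A) (f z.1)%:E)%E.
Proof.
move=> mA fi; have [/measurable_EFinP mf _] := integrableP _ _ _ fi.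
rewrite /marginal /distribution.
apply: (@integral_pushforward _ _ _ _ R fst measurable_fst P A (EFin \o f)) => //.
  exact/measurable_EFinP.
apply: integrableS (integrable_marginal fi) => //.
by rewrite -[Y in measurable Y]setTI; exact: measurable_fst.
Qed.

Let mfstar : measurable_fun setT fstar.
Proof. by have [_ /integrableP[/measurable_EFinP]] := hmean. Qed.

Lemma noise_measurable : measurable_fun setT eps.
Proof.
by apply: measurable_funB => //; exact: measurableT_comp.
Qed.

Let eps2_integrable : P.-integrable setT (fun z => (eps z ^+ 2)%:E).
Proof. by have [] := hvar. Qed.

Let eps_integrable : P.-integrable setT (fun z => (eps z)%:E).
Proof.
have [h1 h2 _] := hmean.
have := integrableB measurableT h1 (integrable_marginal h2).
by apply: eq_integrable.
Qed.

Let abs_eps_integrable : P.-integrable setT (fun z => `|eps z|%:E).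
Proof.
by have := integrable_abse eps_integrable.
Qed.

Let fstA (A : set X) : fst @^-1` A = A `*` [set: R].
Proof. by apply/seteqP; split => -[x y] //= [] . Qed.

Let eps_mean0 (A : set X) : measurable A ->
  (\int[P]_(z in fst @^-1` A) (eps z)%:E = 0)%E.
Proof.
move=> mA.
have mA' : measurable (fst @^-1` A : set (X * R)).
  by rewrite -[X in measurable X]setTI; exact: measurable_fst.
have [h1 h2 h3] := hmean.
have -> : (\int[P]_(z in fst @^-1` A) (eps z)%:E =
   \int[P]_(z in fst @^-1` A) ((snd z)%:E - (fstar z.1)%:E))%E.
  by apply: eq_integral => z _; rewrite /eps /noise EFinB.
have i1 := integrableS measurableT mA' (@subsetT _ _) h1.
have i2 := integrableS measurableT mA' (@subsetT _ _) (integrable_marginal h2).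
rewrite integralB//.
rewrite {1}fstA h3//.
rewrite integral_marginal// subee//.
exact: integrable_fin_num i2.
Qed.

Let mfst_preimage (A : set X) : measurable A -> measurable (fst @^-1` A : set (X * R)).
Proof. by move=> mA; rewrite -[Y in measurable Y]setTI; exact: measurable_fst. Qed.

Lemma integral_noise_weight_le (u : X -> R) : measurable_fun setT u ->
  (forall x, 0 <= u x) ->
  (\int[P]_z (eps z ^+ 2 * u z.1)%:E <= \int[P]_z (sigma ^+ 2 * u z.1)%:E)%E.
Proof.
move=> mu u0; have meps := noise_measurable.
apply: (@le_integral_weight _ _ _ X R P fst (fun z => eps z ^+ 2)
  (fun=> sigma ^+ 2)) => //.
- exact: measurable_funX.
- by move=> z; rewrite sqr_ge0.
- by move=> z; rewrite sqr_ge0.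
- move=> A mA; have mA' := mfst_preimage mA; have [h1 h2 h3] := hvar.
  rewrite {1}fstA h3// integral_marginal//.
  apply: le_integral => //.
  + by apply: integrableS (integrable_marginal h2).
  + exact: finite_measure_integrable_cst.
  + by move=> z _; rewrite lee_fin.
Qed.

Section Bounded.
Variables (u : X -> R) (B : R).
Hypotheses (mu : measurable_fun setT u) (uB : forall x, `|u x| <= B).

Lemma noise_weight_integrable : P.-integrable setT (fun z => (eps z * u z.1)%:E).
Proof.
have meps := noise_measurable.
have B0 : 0 <= B by apply: le_trans (uB point).
have := integrableZl measurableT B abs_eps_integrable.
apply: le_integrable => //.
  by apply/measurable_EFinP; apply: measurable_funM => //; exact: measurableT_comp.
move=> z _ /=; rewrite lee_fin !normrM normr_id mulrC ler_wpM2r//.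
by rewrite (ger0_norm B0).
Qed.

(** For nonnegative [u], [eps] being centred on the events [X \in A] means that
    [`|eps| + eps] and [`|eps|], both nonnegative, have the same integrals over
    them, hence the same integrals against [u]; a bounded [u] becomes
    nonnegative by adding a constant. *)
Lemma noise_weight_mean0 : (\int[P]_z (eps z * u z.1)%:E = 0)%E.
Proof.
have meps := noise_measurable.
have B0 : 0 <= B by apply: le_trans (uB point).
pose u' x := u x + B.
have mu' : measurable_fun setT u' by exact: measurable_funD.
have u'0 x : 0 <= u' x by rewrite /u' -lerBlDr sub0r; have := uB x; rewrite ler_norml => /andP[].
have i1 : P.-integrable setT (fun z => (`|eps z| * u' z.1)%:E).
  have := integrableZl measurableT (2 * B) abs_eps_integrable.
  apply: le_integrable => //.
    apply/measurable_EFinP; apply: measurable_funM => //; exact: measurableT_comp.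
  move=> z _ /=; rewrite lee_fin !normrM normr_id mulrC ler_wpM2r//.
  rewrite ger0_norm// ger0_norm ?mulr_ge0// ger0_norm// mulr_natl mulr2n lerD2r.
  by have := uB z.1; rewrite ler_norml => /andP[].
have i2 : P.-integrable setT (fun z => (eps z * u' z.1)%:E).
  apply: le_integrable i1 => //.
    by apply/measurable_EFinP; apply: measurable_funM => //; exact: measurableT_comp.
  by move=> z _ /=; rewrite lee_fin !normrM normr_id.
have shift (A : set X) : measurable A ->
    (\int[P]_(z in fst @^-1` A) (`|eps z| + eps z)%:E =
     \int[P]_(z in fst @^-1` A) `|eps z|%:E)%E.
  move=> mA; have mA' := mfst_preimage mA.
  under eq_integral do rewrite EFinD.
  rewrite integralD//.
  - by rewrite eps_mean0// adde0.
  - exact: integrableS abs_eps_integrable.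
  - exact: integrableS eps_integrable.
have E : (\int[P]_z ((`|eps z| + eps z) * u' z.1)%:E =
          \int[P]_z (`|eps z| * u' z.1)%:E)%E.
  have ge0 z : 0 <= `|eps z| + eps z by rewrite -{2}(opprK (eps z)) subr_ge0 -normrN ler_norm.
  have mabs : measurable_fun setT (fun z => `|eps z|) by exact: measurableT_comp.
  apply/eqP; rewrite eq_le; apply/andP; split.
    apply: (@le_integral_weight _ _ _ X R P fst (fun z => `|eps z| + eps z)
      (fun z => `|eps z|)) => //.
      exact: measurable_funD.
    by move=> A mA; rewrite shift.
  apply: (@le_integral_weight _ _ _ X R P fst (fun z => `|eps z|)
    (fun z => `|eps z| + eps z)) => //.
    exact: measurable_funD.
  by move=> A mA; rewrite shift.
have Z : (\int[P]_z (eps z * u' z.1)%:E = 0)%E.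
  move: E; under eq_integral do rewrite mulrDl EFinD.
  rewrite integralD//.
  have f1 := integrable_fin_num measurableT i1.
  have f2 := integrable_fin_num measurableT i2.
  rewrite -(fineK f1) -(fineK f2) -EFinD => -[/eqP].
  by rewrite -subr_eq0 addrAC subrr add0r => /eqP ->.
transitivity (\int[P]_z ((eps z * u' z.1)%:E - B%:E * (eps z)%:E))%E.
  by apply: eq_integral => z _; rewrite -EFinM -EFinB /u'; congr _%:E; ring.
rewrite integralB//; last exact: integrableZl.
rewrite Z integralZl//.
have := @eps_mean0 setT measurableT; rewrite preimage_setT => ->.
by rewrite mule0 subee.
Qed.
End Bounded.

(** The cross term disappears because the noise is centred given the design
    point, so only the conditional variance survives. *)
Lemma integral_noise_step (u a : X -> R) (A B : R) :
  measurable_fun setT u -> measurable_fun setT a ->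
  (forall x, `|u x| <= A) -> (forall x, `|a x| <= B) ->
  (\int[P]_z ((u z.1 + eps z * a z.1) ^+ 2)%:E <=
   \int[P]_z (u z.1 ^+ 2 + sigma ^+ 2 * a z.1 ^+ 2)%:E)%E.
Proof.
move=> mu ma uA aB; have meps := noise_measurable.
have A0 : 0 <= A by apply: le_trans (uA point).
have B0 : 0 <= B by apply: le_trans (aB point).
have bnd (f : X -> R) C : measurable_fun setT f -> (forall x, `|f x| <= C) ->
    P.-integrable setT (fun z => (f z.1)%:E).
  move=> mf fC; apply: (bounded_integrable P (f := fun z => f z.1) (b := C)) => //.
  exact: measurableT_comp.
have iu : P.-integrable setT (fun z => (u z.1 ^+ 2)%:E).
  apply: (bnd (fun x => u x ^+ 2) (A ^+ 2)); first exact: measurable_funX.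
  by move=> x; rewrite normrX lerXn2r ?nnegrE.
have ia : P.-integrable setT (fun z => (sigma ^+ 2 * a z.1 ^+ 2)%:E).
  apply: (bnd (fun x => sigma ^+ 2 * a x ^+ 2) (sigma ^+ 2 * B ^+ 2)).
    by apply: measurable_funM => //; exact: measurable_funX.
  move=> x; rewrite normrM (ger0_norm (sqr_ge0 sigma)) ler_wpM2l ?sqr_ge0//.
  by rewrite normrX lerXn2r ?nnegrE.
have mw : measurable_fun setT (fun x => 2 * u x * a x).
  by apply: measurable_funM => //; apply: measurable_funM.
have bw x : `|2 * u x * a x| <= 2 * A * B.
  rewrite !normrM (ger0_norm (ler0n _ 2)); by apply: ler_pM => //; rewrite ?mulr_ge0 ?ler_pM2l.
have ic := noise_weight_integrable mw bw.
have iv : P.-integrable setT (fun z => (eps z ^+ 2 * a z.1 ^+ 2)%:E).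
  have := integrableZl measurableT (B ^+ 2) eps2_integrable.
  apply: le_integrable => //.
    apply/measurable_EFinP; apply: measurable_funM; first exact: measurable_funX.
    by apply: measurable_funX; exact: measurableT_comp.
  move=> z _ /=; rewrite lee_fin.
  rewrite !ger0_norm; [|exact: mulr_ge0 (sqr_ge0 _) (sqr_ge0 _)..].
  rewrite mulrC.
  rewrite ler_wpM2r ?sqr_ge0// -(real_normK (num_real (a z.1))).
  by rewrite lerXn2r ?nnegrE.
have -> : (\int[P]_z ((u z.1 + eps z * a z.1) ^+ 2)%:E =
    \int[P]_z ((u z.1 ^+ 2)%:E + ((eps z * (2 * u z.1 * a z.1))%:E +
    (eps z ^+ 2 * a z.1 ^+ 2)%:E)))%E.
  by apply: eq_integral => z _; rewrite -!EFinD; congr _%:E; ring.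
rewrite integralD//; last exact: integrableD.
rewrite integralD// (noise_weight_mean0 mw bw) add0e.
under [leRHS]eq_integral do rewrite EFinD.
rewrite [leRHS]integralD// leeD2l//.
apply: (@integral_noise_weight_le (fun x => a x ^+ 2)).
  exact: measurable_funX.
by move=> x; rewrite sqr_ge0.
Qed.

End Noise.

Lemma jointly_measurable_comp (dT dU : measure_display) (T : measurableType dT)
    (U : measurableType dU) (R : realType) (N : nat) (p : T -> U)
    (F : ('I_N -> U) -> R) :
  measurable_fun setT p -> jointly_measurable F ->
  jointly_measurable (fun z : 'I_N -> T => F (fun k => p (z k))).
Proof.
move=> mp mF d S z mz; apply: (mF d S (fun k w => p (z k w))) => k.
exact: measurableT_comp.
Qed.

Lemma jointly_measurable_coord (dT : measure_display) (T : measurableType dT)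
    (R : realType) (N : nat) (k : 'I_N) (f : T -> R) :
  measurable_fun setT f -> jointly_measurable (fun z : 'I_N -> T => f (z k)).
Proof. by move=> mf d S z mz; exact: measurableT_comp. Qed.

(** * Consequences for sums over the sample *)

Section Sample.
Context {dT dO : measure_display} {T : measurableType dT}
  {Om : measurableType dO} {R : realType} {N : nat}.
Variables (P : probability T R) (nu : {finite_measure set Om -> \bar R})
  (Z : 'I_N -> Om -> T).
Hypothesis mZ : forall k, measurable_fun setT (Z k).
Hypothesis indepZ : forall B : 'I_N -> set T, (forall k, measurable (B k)) ->
  nu [set w | forall k, B k (Z k w)] = (nu setT * \prod_(k < N) P (B k))%E.

(** [G t] is the integrand in which the first [t] coordinates have already been
    integrated out. *)
Lemma le_integral_telescope (G : nat -> ('I_N -> T) -> R) :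
  (forall t, jointly_measurable (G t)) -> (forall t z, 0 <= G t z) ->
  (forall (j : 'I_N) z, (\int[P]_x (G j (replace_coord z j x))%:E <=
                         \int[P]_x (G j.+1 (replace_coord z j x))%:E)%E) ->
  (\int[nu]_w (G 0%N (fun k => Z k w))%:E <= \int[nu]_w (G N (fun k => Z k w))%:E)%E.
Proof.
move=> mG G0 Gstep.
suff : forall t, (t <= N)%N -> (\int[nu]_w (G 0%N (fun k => Z k w))%:E <=
    \int[nu]_w (G t (fun k => Z k w))%:E)%E by apply.
elim=> [//|t IH tN]; apply: le_trans (IH (ltnW tN)) _.
apply: (@le_integral_coordinate _ _ _ _ _ _ P nu Z mZ indepZ (Ordinal tN)
  (G t) (G t.+1)) => //.
exact: (Gstep (Ordinal tN)).
Qed.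

Lemma integral_coordinate_le (j : 'I_N) (g : T -> R) (c : R) :
  measurable_fun setT g -> (forall x, 0 <= g x) -> 0 <= c ->
  (\int[P]_x (g x)%:E <= c%:E)%E ->
  (\int[nu]_w (g (Z j w))%:E <= c%:E * nu setT)%E.
Proof.
move=> mg g0 c0 gc; rewrite -integral_cst//.
apply: (@le_integral_coordinate _ _ _ _ _ _ P nu Z mZ indepZ j
  (fun z => g (z j)) (fun=> c)) => //.
- exact: jointly_measurable_coord.
- move=> z; under eq_integral do rewrite /replace_coord eqxx.
  by rewrite integral_cst// [X in (_ * X)%E](@probability_setT _ _ _ P) mule1.
Qed.

(** Chernoff's product bound: each coordinate of [S] in turn contributes a factor
    at most [kap]. *)
Lemma integral_expR_sum_le (h : T -> R) (kap : R) (S : {set 'I_N}) :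
  measurable_fun setT h -> 0 <= kap ->
  (\int[P]_x (expR (h x))%:E <= kap%:E)%E ->
  (\int[nu]_w (expR (\sum_(k in S) h (Z k w)))%:E <= (kap ^+ #|S|)%:E * nu setT)%E.
Proof.
move=> mh kap0 hkap.
have mexp (t : nat) : jointly_measurable (fun z : 'I_N -> T =>
    expR (\sum_(k in S | (t <= k)%N) h (z k))).
  move=> d S' z mz; apply: (measurableT_comp (@measurable_expR R)).
  have -> : (fun w : S' => \sum_(k in S | (t <= k)%N) h (z k w)) =
      (fun w => \sum_k (if (k \in S) && (t <= k)%N then h (z k w) else 0)).
    by apply/funext => w; exact: big_mkcond.
  apply: measurable_sum => k; case: (_ && _) => //.
  exact: measurableT_comp.
pose G (t : nat) (z : 'I_N -> T) := kap ^+ #|[set k in S | (k < t)%N]%SET| *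
  expR (\sum_(k in S | (t <= k)%N) h (z k)).
have -> : (\int[nu]_w (expR (\sum_(k in S) h (Z k w)))%:E =
    \int[nu]_w (G 0%N (fun k => Z k w))%:E)%E.
  apply: eq_integral => w _; rewrite /G.
  have -> : [set k in S | (k < 0)%N]%SET = finset.set0.
    by apply/setP => k; rewrite !inE andbF.
  rewrite cards0 expr0 mul1r; congr (expR _)%:E.
  by apply: eq_bigl => k; rewrite andbT.
have -> : ((kap ^+ #|S|)%:E * nu setT = \int[nu]_w (G N (fun k => Z k w))%:E)%E.
  rewrite -integral_cst//; apply: eq_integral => w _; rewrite /G /=.
  have -> : [set k in S | (k < N)%N]%SET = S.
    by apply/setP => k; rewrite !inE ltn_ord andbT.
  rewrite big1 ?expR0 ?mulr1// => k /andP[_].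
  by rewrite leqNgt ltn_ord.
apply: le_integral_telescope => [t|t z|j z].
- by move=> d S' z mz; apply: measurable_funM => //; exact: mexp.
- by rewrite mulr_ge0 ?exprn_ge0 ?expR_ge0.
- have [jS|jS] := boolP (j \in S); last first.
    rewrite le_eqVlt; apply/orP; left; apply/eqP; apply: eq_integral => x _.
    congr (_ %:E); rewrite /G; congr (_ ^+ _ * expR _).
      apply: eq_card => k; rewrite !inE ltnS (leq_eqVlt k j).
      have [->|kj] := eqVneq k j; first by rewrite (negbTE jS).
      by rewrite (negbTE (kj : (k != j :> nat))).
    apply: eq_bigl => k; rewrite (leq_eqVlt j k).
    have [->|kj] := eqVneq k j; first by rewrite (negbTE jS).
    by rewrite eq_sym (negbTE (kj : (k != j :> nat))).
  pose rest := \sum_(k in S | (j < k)%N) h (z k).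
  have E0 x : G j (replace_coord z j x) = kap ^+ #|[set k in S | (k < j)%N]%SET| *
      (expR (h x) * expR rest).
    rewrite /G; congr (_ * _); rewrite -expRD; congr expR.
    rewrite (bigD1 j) ?jS ?leqnn//= /replace_coord eqxx; congr (_ + _).
    apply: eq_big => k; first by rewrite (ltn_neqAle j k) eq_sym -andbA [X in _ = _ && X]andbC.
    by move=> /andP[_ /negbTE ->].
  have E1 x : G j.+1 (replace_coord z j x) =
      kap ^+ #|[set k in S | (k < j)%N]%SET| * (kap * expR rest).
    rewrite /G mulrA -exprSr; congr (_ ^+ _ * expR _).
      rewrite (cardsD1 j) inE jS ltnSn add1n; congr (_.+1).
      apply: eq_card => k; rewrite !inE ltnS.
      by rewrite (ltn_neqAle k j) andbCA.
    apply: eq_bigr => k /andP[_ jk]; rewrite /replace_coord; case: eqP => // kj.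
    by move: jk; rewrite kj ltnn.
  (under eq_integral => x _ do rewrite E0).
  (under [leRHS]eq_integral => x _ do rewrite E1).
  rewrite [leRHS]integral_cst// [X in (_ <= _ * X)%E](@probability_setT _ _ _ P) mule1.
  have c0 : 0 <= kap ^+ #|[set k in S | (k < j)%N]%SET| * expR rest.
    by rewrite mulr_ge0 ?exprn_ge0 ?expR_ge0.
  pose c := kap ^+ #|[set k in S | (k < j)%N]%SET|; rewrite -/c in c0 *.
  have -> : (\int[P]_x (c * (expR (h x) * expR rest))%:E =
      (c * expR rest)%:E * \int[P]_x (expR (h x))%:E)%E.
    rewrite -ge0_integralZl_EFin//.
    - by apply: eq_integral => x _; rewrite -EFinM; congr _%:E; ring.
    - apply/measurable_EFinP; exact: (measurableT_comp (@measurable_expR R)).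
  apply: (@le_trans _ _ ((c * expR rest)%:E * kap%:E)%E); first exact: lee_wpmul2l.
  by rewrite -EFinM lee_fin -!mulrA (mulrC kap).
Qed.
End Sample.

Lemma jointly_measurable_sum (dT : measure_display) (T : measurableType dT)
    (R : realType) (N : nat) (I : finType) (Q : pred I)
    (F : I -> ('I_N -> T) -> R) :
  (forall i, jointly_measurable (F i)) ->
  jointly_measurable (fun z => \sum_(i | Q i) F i z).
Proof.
move=> mF d S z mz.
have -> : (fun w : S => \sum_(i | Q i) F i (fun k => z k w)) =
    (fun w => \sum_i (if Q i then F i (fun k => z k w) else 0)).
  by apply/funext => w; exact: big_mkcond.
by apply: measurable_sum => i; case: (Q i) => //; exact: mF.
Qed.

Section NoiseSum.
Context {d dO : measure_display} {X : measurableType d}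
  {Om : measurableType dO} {R : realType} {N : nat}.
Variables (P : probability (X * R)%type R)
  (nu : {finite_measure set Om -> \bar R}) (Z : 'I_N -> Om -> X * R)
  (fstar v : X -> R) (sigma : R).
Hypothesis mZ : forall k, measurable_fun setT (Z k).
Hypothesis indepZ : forall B : 'I_N -> set (X * R),
  (forall k, measurable (B k)) ->
  nu [set w | forall k, B k (Z k w)] = (nu setT * \prod_(k < N) P (B k))%E.
Hypotheses (hmean : is_cond_exp P snd fstar)
  (hvar : is_cond_exp P (fun z => (z.2 - fstar z.1) ^+ 2) v)
  (hv : forall x, v x <= sigma ^+ 2).

Let design (z : 'I_N -> X * R) : 'I_N -> X := fun k => (z k).1.

(** The weights depend on the whole design, so the sum has no martingale
    structure; but freezing all coordinates except [j] leaves in the square an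
    expression [u + eps a] with [u] and [a] functions of the [j]-th design point,
    to which [integral_noise_step] applies. *)
Lemma integral_noise_sum_le (a : 'I_N -> ('I_N -> X) -> R) (B : R) :
  (forall k, jointly_measurable (a k)) -> (forall k x, `|a k x| <= B) ->
  (\int[nu]_w ((\sum_k noise fstar (Z k w) * a k (fun i => (Z i w).1)) ^+ 2)%:E <=
   \int[nu]_w (sigma ^+ 2 * \sum_k a k (fun i => (Z i w).1) ^+ 2)%:E)%E.
Proof.
move=> ma aB; have meps := noise_measurable hmean.
have mad k : jointly_measurable (fun z => a k (design z)).
  exact: (jointly_measurable_comp measurable_fst (ma k)).
pose G (t : nat) (z : 'I_N -> X * R) :=
  (\sum_(k < N | (t <= k)%N) noise fstar (z k) * a k (design z)) ^+ 2 +
  sigma ^+ 2 * \sum_(k < N | (k < t)%N) a k (design z) ^+ 2.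
have -> : (\int[nu]_w ((\sum_k noise fstar (Z k w) * a k (fun i => (Z i w).1)) ^+ 2)%:E
    = \int[nu]_w (G 0%N (fun k => Z k w))%:E)%E.
  apply: eq_integral => w _; congr _%:E; rewrite /G [X in _ * X]big1 ?mulr0 ?addr0//.
have -> : (\int[nu]_w (sigma ^+ 2 * \sum_k a k (fun i => (Z i w).1) ^+ 2)%:E
    = \int[nu]_w (G N (fun k => Z k w))%:E)%E.
  apply: eq_integral => w _; congr _%:E; rewrite /G [X in X ^+ 2 + _]big1.
    rewrite expr0n add0r; congr (_ * _); apply: eq_bigl => k.
    by rewrite ltn_ord.
  by move=> k; rewrite leqNgt ltn_ord.
have mG t : jointly_measurable (G t).
  move=> d' S z mz; apply: measurable_funD.
    apply: measurable_funX; apply: (@jointly_measurable_sum _ _ R N _ _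
      (fun k z => noise fstar (z k) * a k (design z))) => // k.
    move=> d'' S' z' mz'; apply: measurable_funM; last exact: mad.
    exact: measurableT_comp.
  apply: measurable_funM => //.
  apply: (@jointly_measurable_sum _ _ R N _ _
    (fun k z => a k (design z) ^+ 2)) => // k.
  by move=> d'' S' z' mz'; apply: measurable_funX; exact: mad.
apply: (le_integral_telescope mZ indepZ) => // [t z|j z].
  rewrite addr_ge0 ?sqr_ge0// mulr_ge0 ?sqr_ge0// sumr_ge0// => k _.
  exact: sqr_ge0.
(* With the coordinates other than [j] frozen, [xi x] is the design in which the
   [j]-th point is x. *)
pose xi (x : X) : 'I_N -> X := fun k => if k == j then x else (z k).1.
have xiE p : design (replace_coord z j p) = xi p.1.
  by apply/funext => k; rewrite /design /replace_coord /xi; case: eqP.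
have mxi k : measurable_fun setT (fun x => xi x k).
  by rewrite /xi; case: (k == j).
have maxi k : measurable_fun setT (fun x => a k (xi x)) by exact: ma.
pose u x := \sum_(k < N | (j < k)%N) noise fstar (z k) * a k (xi x).
pose c x := sigma ^+ 2 * \sum_(k < N | (k < j)%N) a k (xi x) ^+ 2.
have mu : measurable_fun setT u.
  apply: (@jointly_measurable_sum _ _ R N _ _ (fun k x => noise fstar (z k) * a k x)
    _ _ X (fun k x => xi x k)) => // k d' S z' mz'.
  by apply: measurable_funM => //; exact: ma.
have mc : measurable_fun setT c.
  apply: measurable_funM => //.
  apply: (@jointly_measurable_sum _ _ R N _ _ (fun k x => a k x ^+ 2)
    _ _ X (fun k x => xi x k)) => // k d' S z' mz'.
  by apply: measurable_funX; exact: ma.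
have c0 x : 0 <= c x.
  by rewrite mulr_ge0 ?sqr_ge0// sumr_ge0// => k _; exact: sqr_ge0.
have uB x : `|u x| <= \sum_(k < N | (j < k)%N) `|noise fstar (z k)| * B.
  apply: le_trans (ler_norm_sum _ _ _) _; apply: ler_sum => k _.
  by rewrite normrM ler_wpM2l.
have E0 p : G j (replace_coord z j p) = (u p.1 + noise fstar p * a j (xi p.1)) ^+ 2 + c p.1.
  rewrite /G xiE; congr (_ ^+ 2 + _).
  rewrite (bigD1 j) ?leqnn//= addrC; congr (_ + _); last by rewrite /replace_coord eqxx.
  apply: eq_big => k; first by rewrite (ltn_neqAle j k) eq_sym andbC.
  by move=> /andP[_ /negbTE kj]; rewrite /replace_coord kj.
have E1 p : G j.+1 (replace_coord z j p) = (u p.1 ^+ 2 + sigma ^+ 2 * a j (xi p.1) ^+ 2) + c p.1.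
  rewrite /G xiE -addrA; congr (_ ^+ 2 + _).
    apply: eq_bigr => k jk; rewrite /replace_coord; case: eqP => // kj.
    by move: jk; rewrite kj ltnn.
  rewrite -mulrDr; congr (_ * _); rewrite (bigD1 j) ?leqnn//=; congr (_ + _).
  by apply: eq_bigl => k; rewrite (ltn_neqAle k j) ltnS andbC.
have mcP : measurable_fun setT (fun p : X * R => (c p.1)%:E).
  by apply/measurable_EFinP; exact: (measurableT_comp mc).
have cP0 (p : X * R) : setT p -> (0 <= (c p.1)%:E)%E by rewrite lee_fin.
have muP : measurable_fun setT (fun p : X * R => u p.1).
  exact: (measurableT_comp mu).
have maP : measurable_fun setT (fun p : X * R => a j (xi p.1)).
  exact: (measurableT_comp (maxi j)).
(under eq_integral => p _ do rewrite E0 EFinD).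
(under [leRHS]eq_integral => p _ do rewrite E1 EFinD).
rewrite !ge0_integralD//.
- apply: leeD2r.
  exact: (integral_noise_step hmean hvar hv mu (maxi j) uB (fun x => aB j (xi x))).
- by move=> p _; rewrite lee_fin addr_ge0 ?sqr_ge0// mulr_ge0 ?sqr_ge0.
- apply/measurable_EFinP; apply: measurable_funD; first exact: measurable_funX.
  by apply: measurable_funM => //; exact: measurable_funX.
- by move=> p _; rewrite lee_fin sqr_ge0.
- apply/measurable_EFinP; apply: measurable_funX; apply: measurable_funD => //.
  exact: measurable_funM.
Qed.

End NoiseSum.

(** * Ridge regression: deterministic bounds *)

Section Dot.
Context {R : realType} {q : nat}.
Implicit Types u v : 'cV[R]_q.

Definition dot u v : R := \sum_l u l 0 * v l 0.

Lemma dotC u v : dot u v = dot v u.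
Proof. by apply: eq_bigr => l _; rewrite mulrC. Qed.

Lemma dot_ge0 u : 0 <= dot u u.
Proof. by apply: sumr_ge0 => l _; exact: sqr_ge0. Qed.

Lemma dot_eq0 u : dot u u = 0 -> u = 0.
Proof.
move=> /eqP; rewrite psumr_eq0; last by move=> l _; exact: sqr_ge0.
move=> /allP h; apply/colP => l; rewrite mxE.
have := h l (mem_index_enum _); rewrite mulf_eq0 orbb.
by move=> /eqP.
Qed.

Lemma dotDr u v w : dot u (v + w) = dot u v + dot u w.
Proof.
by rewrite /dot -big_split; apply: eq_bigr => l _; rewrite mxE mulrDr.
Qed.

Lemma dotZr c u v : dot u (c *: v) = c * dot u v.
Proof.
by rewrite /dot mulr_sumr; apply: eq_bigr => l _; rewrite mxE mulrCA.
Qed.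

Lemma dot_sumr (I : finType) (Q : pred I) u (F : I -> 'cV[R]_q) :
  dot u (\sum_(i | Q i) F i) = \sum_(i | Q i) dot u (F i).
Proof.
rewrite exchange_big; apply: eq_bigr => l _.
by rewrite summxE mulr_sumr.
Qed.

(** With [v = A^-1 u], [kap |v|^2 <= <v, u>] and [<v, u>] is split by the
    arithmetic-geometric mean inequality. *)
Lemma dot_invmx_le (A : 'M[R]_q) (kap : R) u : 0 < kap -> A \in unitmx ->
  (forall v, kap * dot v v <= dot v (A *m v)) ->
  dot (invmx A *m u) (invmx A *m u) <= kap ^- 2 * dot u u.
Proof.
move=> kap0 Au hA; set v := invmx A *m u.
have Av : A *m v = u by rewrite mulKVmx.
have h1 := hA v; rewrite Av in h1.
have h2 : 2 * kap * dot v u <= kap ^+ 2 * dot v v + dot u u.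
  rewrite /dot !mulr_sumr -big_split /=; apply: ler_sum => l _.
  have := sqr_ge0 (kap * v l 0 - u l 0); lra.
rewrite mulrC ler_pdivlMr ?exprn_gt0//.
have h3 : kap * (kap * dot v v) <= kap * dot v u by rewrite ler_pM2l.
lra.
Qed.

Lemma unitmx_of_posdef (A : 'M[R]_q) (kap : R) : 0 < kap ->
  (forall v, kap * dot v v <= dot v (A *m v)) -> A \in unitmx.
Proof.
move=> kap0 hA; rewrite unitmxE unitfE -det_tr; apply/det0P => -[w w0 wA].
have Aw : A *m w^T = 0.
  by apply: trmx_inj; rewrite trmx_mul trmxK wA trmx0.
have := hA w^T; rewrite Aw.
have -> : dot w^T 0 = 0 by rewrite /dot big1// => l _; rewrite [X in _ * X]mxE mulr0.
rewrite pmulr_rle0// => h; move/eqP: w0; apply.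
apply: trmx_inj; rewrite trmx0; apply: dot_eq0.
by apply/eqP; rewrite eq_le h dot_ge0.
Qed.

End Dot.

Section Ridge.
Context {R : realType} {q N : nat}.
Variables (S : {set 'I_N}) (lam : R) (imu : 'I_q -> R).
Implicit Types (f : 'I_N -> 'cV[R]_q) (u v : 'cV[R]_q).

(** The penalty [lam * ||.||^2] of the RKHS has the matrix [lam * diag (imu)] in
    the coordinates of the eigenfunctions, [imu] being the inverse eigenvalues. *)
Definition ridge_mx f : 'M[R]_q :=
  #|S|%:R^-1 *: (\sum_(k in S) f k *m (f k)^T) +
  lam *: diag_mx (\row_l imu l).

Definition second_moment f u : R := #|S|%:R^-1 * \sum_(k in S) dot (f k) u ^+ 2.

Lemma dot_ridge f u : dot u (ridge_mx f *m u) =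
  second_moment f u + lam * \sum_l imu l * u l 0 ^+ 2.
Proof.
have rank1 k : f k *m (f k)^T *m u = dot (f k) u *: f k.
  rewrite -mulmxA; apply/colP => l; rewrite !mxE big_ord1 mulrC; congr (_ * _).
  by rewrite mxE; apply: eq_bigr => i _; rewrite mxE.
rewrite /ridge_mx mulmxDl -!scalemxAl mulmx_suml dotDr !dotZr.
rewrite dot_sumr; congr (_ * _ + _ * _).
  by apply: eq_bigr => k _; rewrite rank1 dotZr expr2 (dotC u).
apply: eq_bigr => l _; rewrite mul_diag_mx !mxE; ring.
Qed.

Section Bounds.
Variables (f : 'I_N -> 'cV[R]_q) (kap : R).
Hypotheses (lam_gt0 : 0 < lam) (kap_gt0 : 0 < kap)
  (imu_ge : forall l, kap^-1 <= imu l).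

Lemma second_moment_ge0 u : 0 <= second_moment f u.
Proof.
apply: mulr_ge0; first by rewrite invr_ge0.
by apply: sumr_ge0 => k _; exact: sqr_ge0.
Qed.

Lemma ridge_ge_penalty u : lam / kap * dot u u <= dot u (ridge_mx f *m u).
Proof.
rewrite dot_ridge ler_wpDl ?second_moment_ge0// -mulrA ler_pM2l//.
by rewrite mulr_sumr; apply: ler_sum => l _; rewrite ler_wpM2r ?sqr_ge0.
Qed.

Lemma ridge_unitmx : ridge_mx f \in unitmx.
Proof.
by apply: (@unitmx_of_posdef _ _ _ (lam / kap)); [rewrite divr_gt0|exact: ridge_ge_penalty].
Qed.

Lemma ridge_ge_moment u : second_moment f u <= dot u (ridge_mx f *m u).
Proof.
rewrite dot_ridge lerDl; apply: mulr_ge0; first exact: ltW.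
apply: sumr_ge0 => l _.
by rewrite mulr_ge0 ?sqr_ge0// (le_trans _ (imu_ge l))// invr_ge0 ltW.
Qed.

Lemma dot_ridge_inv_le u :
  dot (invmx (ridge_mx f) *m u) (invmx (ridge_mx f) *m u) <=
  (kap / lam) ^+ 2 * dot u u.
Proof.
have := @dot_invmx_le _ _ (ridge_mx f) (lam / kap) u (divr_gt0 lam_gt0 kap_gt0)
  ridge_unitmx ridge_ge_penalty.
by rewrite -exprVn invf_div.
Qed.

Lemma dot_ridge_inv_le4 u :
  (forall v, 2^-1 * dot v v <= second_moment f v) ->
  dot (invmx (ridge_mx f) *m u) (invmx (ridge_mx f) *m u) <= 4 * dot u u.
Proof.
move=> h; have := @dot_invmx_le _ _ (ridge_mx f) 2^-1 u _ ridge_unitmx _.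
rewrite -exprVn invrK => h'; apply: le_trans (h' _ _) _.
- by rewrite invr_gt0.
- by move=> v; exact: le_trans (h v) (ridge_ge_moment v).
- by rewrite expr2; lra.
Qed.

(** A single summand already gives [v' A v >= <f_k, v>^2 / n]; at [v = A^-1 f_k]
    both sides involve [p = <f_k, v>], so that [p^2 / n <= p]. *)
Lemma dot_ridge_inv_feature_le k : k \in S ->
  dot (invmx (ridge_mx f) *m f k) (invmx (ridge_mx f) *m f k) <=
  kap / lam * #|S|%:R.
Proof.
move=> kS; set v := invmx _ *m _.
have Av : ridge_mx f *m v = f k by rewrite mulKVmx// ridge_unitmx.
have n0 : 0 < #|S|%:R :> R by rewrite ltr0n; apply/card_gt0P; exists k.
set p := dot v (f k).
have h1 : lam / kap * dot v v <= p by rewrite /p -{1}Av ridge_ge_penalty.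
have p0 : 0 <= p by apply: le_trans h1; rewrite mulr_ge0 ?dot_ge0// divr_ge0 ?ltW.
have h2 : p ^+ 2 <= #|S|%:R * p.
  have : second_moment f v <= p by rewrite /p -{1}Av ridge_ge_moment.
  rewrite /second_moment ler_pdivrMl// => /(le_trans _); apply.
  rewrite (bigD1 k)//= (dotC (f k)) lerDl sumr_ge0// => i _.
  exact: sqr_ge0.
have h3 : p <= #|S|%:R.
  have [->|pn0] := eqVneq p 0; first exact: ltW.
  have pgt0 : 0 < p by rewrite lt_def pn0.
  by rewrite -(ler_pM2r pgt0) -expr2.
have h4 : lam / kap * dot v v <= #|S|%:R by exact: le_trans h3.
by rewrite -ler_pdivrMl ?divr_gt0// invf_div.
Qed.

End Bounds.
End Ridge.

Section Truncation.
Context {R : realType} {q N r : nat}.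
Variables (S : {set 'I_N}) (f : 'I_N -> 'cV[R]_q) (w : 'I_N -> R)
  (m : 'I_q -> 'I_q -> R).
Hypotheses (qr : (q <= r)%N) (r_gt0 : (0 < r)%N) (w01 : forall k, 0 <= w k <= 1)
  (m_near : forall l l', `|m l l' - (l == l')%:R| <= (4 * r%:R)^-1)
  (emp_near : forall l l',
    `|#|S|%:R^-1 * \sum_(k in S) w k * f k l 0 * f k l' 0 - m l l'|
      <= (4 * r%:R)^-1).

(** Inserting a weight in [0,1] only decreases the second moment, and an
    entrywise error of [1 / (2 r)] perturbs the identity by at most [1 / 2]. *)
Lemma second_moment_ge_half v : 2^-1 * dot v v <= second_moment S f v.
Proof.
have r0 : 0 < r%:R :> R by rewrite ltr0n.
have rn0 : r%:R != 0 :> R by rewrite gt_eqF.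
pose g l l' := #|S|%:R^-1 * \sum_(k in S) w k * f k l 0 * f k l' 0.
have h1 : \sum_l \sum_l' v l 0 * v l' 0 * g l l' <= second_moment S f v.
  have -> : \sum_l \sum_l' v l 0 * v l' 0 * g l l' =
      #|S|%:R^-1 * \sum_(k in S) w k * dot (f k) v ^+ 2.
    transitivity (\sum_l \sum_l' \sum_(k in S)
      #|S|%:R^-1 * (w k * (f k l 0 * v l 0) * (f k l' 0 * v l' 0))).
      apply: eq_bigr => l _; apply: eq_bigr => l' _.
      rewrite /g mulrCA mulr_sumr mulr_sumr; apply: eq_bigr => k _.
      by rewrite -!mulrA; congr (_ * _); ring.
    under eq_bigr do rewrite exchange_big /=.
    rewrite exchange_big /= mulr_sumr; apply: eq_bigr => k _.
    rewrite expr2 /dot !mulr_suml !mulr_sumr; apply: eq_bigr => l _.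
    rewrite !mulr_sumr; apply: eq_bigr => l' _; ring.
  rewrite ler_wpM2l ?invr_ge0//; apply: ler_sum => k _.
  by have /andP[w0 w1] := w01 k; rewrite ler_piMl ?sqr_ge0.
apply: le_trans h1.
have gnear l l' : `|g l l' - (l == l')%:R| <= (2 * r%:R)^-1.
  have -> : (2 * r%:R)^-1 = (4 * r%:R)^-1 + (4 * r%:R)^-1 :> R by field.
  rewrite (_ : g l l' - _ = (g l l' - m l l') + (m l l' - (l == l')%:R)); last by ring.
  by apply: le_trans (ler_normD _ _) _; apply: lerD; [exact: emp_near|exact: m_near].
have h2 l l' : v l 0 * v l' 0 * (l == l')%:R -
    (2 * r%:R)^-1 * (2^-1 * (v l 0 ^+ 2 + v l' 0 ^+ 2)) <= v l 0 * v l' 0 * g l l'.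
  rewrite lerBlDr -lerBlDl -mulrBr.
  apply: le_trans (ler_norm _) _; rewrite normrM mulrC distrC.
  apply: ler_pM => //; rewrite normrM.
  have := sqr_ge0 (`|v l 0| - `|v l' 0|).
  by rewrite sqrrB !real_normK ?num_real//; lra.
have h3 : \sum_l \sum_l' (v l 0 * v l' 0 * (l == l')%:R -
    (2 * r%:R)^-1 * (2^-1 * (v l 0 ^+ 2 + v l' 0 ^+ 2))) <=
    \sum_l \sum_l' v l 0 * v l' 0 * g l l'.
  by apply: ler_sum => l _; apply: ler_sum => l' _.
apply: le_trans h3.
have sumd : \sum_l \sum_l' v l 0 * v l' 0 * (l == l')%:R = dot v v.
  apply: eq_bigr => l _; rewrite (bigD1 l)//= eqxx mulr1 big1 ?addr0// => l' /negbTE.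
  by rewrite eq_sym => ->; rewrite mulr0.
have sq : dot v v = \sum_l v l 0 ^+ 2 by [].
have sums : \sum_(l < q) \sum_(l' < q) (2 * r%:R)^-1 * (2^-1 * (v l 0 ^+ 2 + v l' 0 ^+ 2))
    = (2 * r%:R)^-1 * (q%:R * dot v v).
  have inner l : \sum_(l' < q) (2 * r%:R)^-1 * (2^-1 * (v l 0 ^+ 2 + v l' 0 ^+ 2)) =
      (2 * r%:R)^-1 * (2^-1 * (q%:R * v l 0 ^+ 2 + dot v v)).
    by rewrite -mulr_sumr -mulr_sumr big_split /= -sq sumr_const card_ord -[_ *+ q]mulr_natl.
  under eq_bigr do rewrite inner.
  rewrite -!mulr_sumr big_split /= -mulr_sumr -sq sumr_const card_ord -[_ *+ q]mulr_natl.
  by congr (_ * _); lra.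
under eq_bigr do rewrite sumrB.
rewrite sumrB sumd sums.
have : (2 * r%:R)^-1 * (q%:R * dot v v) <= 2^-1 * dot v v.
  rewrite invfM -mulrA ler_pM2l ?invr_gt0// mulrA ler_piMl ?dot_ge0//.
  by rewrite ler_pdivrMl// mulr1 ler_nat.
lra.
Qed.

End Truncation.

(** * The RKHS of a kernel of finite rank *)

Section FiniteRank.
Context {X : Type} {R : realType}.
Variables (K : X -> X -> R) (H : set (X -> R)) (ip : (X -> R) -> (X -> R) -> R)
  (q : nat) (mu : 'I_q -> R) (phi : 'I_q -> X -> R).
Hypotheses (rkhs : is_rkhs K H ip)
  (K_sum : forall x y, K x y = \sum_l mu l * phi l x * phi l y).

Lemma rkhs_comb (n : nat) (c : 'I_n -> R) (h : 'I_n -> X -> R) :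
  (forall i, H (h i)) -> H (\sum_i c i *: h i) /\
  forall g, H g -> ip (\sum_i c i *: h i) g = \sum_i c i * ip (h i) g.
Proof.
move=> Hh; elim: n c h Hh => [|n IH] c h Hh.
  rewrite big_ord0; split; first exact: rkhs_zero rkhs.
  move=> g Hg; rewrite big_ord0.
  have := rkhs_linear rkhs 1 (rkhs_zero rkhs) (rkhs_zero rkhs) Hg.
  rewrite scale1r addr0 mul1r => /eqP.
  by rewrite -subr_eq0 opprD addrA subrr add0r oppr_eq0 => /eqP.
rewrite big_ord_recl; have [H1 H2] := IH (fun i => c (lift ord0 i))
  (fun i => h (lift ord0 i)) (fun i => Hh (lift ord0 i)).
split; first exact: rkhs_closed rkhs _ _ _ (Hh _) H1.
by move=> g Hg; rewrite (rkhs_linear rkhs)// H2// big_ord_recl.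
Qed.

Let section_row (x : X) : 'rV[R]_q := \row_l (mu l * phi l x).

(* The points are chosen to maximise the rank of their matrix of coordinates. *)
Let spanning_points : exists (n : nat) (p : 'I_n -> X), forall x,
  (section_row x <= \matrix_(i < n) section_row (p i))%MS.
Proof.
pose Q k := `[< exists (n : nat) (p : 'I_n -> X),
  \rank (\matrix_(i < n) section_row (p i)) = k >].
have Q0 : exists k, Q k.
  exists (\rank (\matrix_(i < 0) section_row (ffun0 (card_ord 0) i))).
  by apply/asboolP; exists 0%N, (ffun0 (card_ord 0)).
have Qle k : Q k -> (k <= q)%N by move=> /asboolP[n [p <-]]; exact: rank_leq_col.
case: (ex_maxnP Q0 Qle) => k /asboolP[n [p pk]] kmax.
exists n, p => x; set A := \matrix_(i < n) _.
pose p' (i : 'I_(n + 1)) := if fintype.split i is inl j then p j else x.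
have A'E : \matrix_(i < n + 1) section_row (p' i) = col_mx A (section_row x).
  apply/row_matrixP => i; rewrite rowK /p'; case: fintype.splitP => j ij.
    by rewrite (_ : i = lshift 1 j) ?rowKu ?rowK//; exact: val_inj.
  rewrite (_ : i = rshift n j); last exact: val_inj.
  by rewrite rowKd (ord1 j) row_id.
have sub : (A <= col_mx A (section_row x))%MS.
  by apply/submxP; exists (row_mx 1%:M 0); rewrite mul_row_col mul1mx mul0mx addr0.
have /leqifP := mxrank_leqif_sup sub.
case: ifP => [|_]; first by rewrite col_mx_sub => /andP[].
have : (\rank (col_mx A (section_row x)) <= k)%N.
  by apply: kmax; apply/asboolP; exists (n + 1)%N, p'; rewrite A'E.
by rewrite -pk leqNgt => /negbTE ->.
Qed.

(** If [K ^~ x] is a combination of the [K ^~ p_i], with coefficients linear in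
    the coordinates of [K ^~ x], then [f x = <f, K ^~ x>] is the same combination
    of the values [f (p_i)], hence linear in these coordinates. *)
Lemma rkhs_coordinates (f : X -> R) : H f ->
  exists b : 'I_q -> R, forall x, f x = \sum_l mu l * b l * phi l x.
Proof.
move=> Hf; have [n [p hp]] := spanning_points.
set A := \matrix_(i < n) section_row (p i) in hp.
pose F : 'cV[R]_n := \col_i f (p i).
exists (fun l => (pinvmx A *m F) l 0) => x.
pose c := section_row x *m pinvmx A.
have cA : c *m A = section_row x by exact: mulmxKpV.
have KE : K ^~ x = \sum_i c 0 i *: K ^~ (p i).
  apply/funext => y; rewrite fct_sumE /= K_sum.
  have -> : \sum_l mu l * phi l y * phi l x = \sum_l section_row x 0 l * phi l y.
    by apply: eq_bigr => l _; rewrite mxE mulrAC.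
  have rowE l : section_row x 0 l = \sum_i c 0 i * A i l by rewrite -cA mxE.
  transitivity (\sum_l \sum_i c 0 i * A i l * phi l y).
    by apply: eq_bigr => l _; rewrite rowE mulr_suml.
  rewrite exchange_big /=; apply: eq_bigr => i _.
  rewrite -[RHS]/(c 0 i * K y (p i)) K_sum mulr_sumr; apply: eq_bigr => l _.
  by rewrite !mxE -!mulrA; congr (_ * (_ * _)); rewrite mulrC.
have HK i : H (K ^~ (p i)) := rkhs_kernel rkhs (p i).
have [HS ipS] := rkhs_comb (fun i => c 0 i) HK.
rewrite -(rkhs_reproducing rkhs x Hf) (rkhs_sym rkhs Hf (rkhs_kernel rkhs x)) KE ipS//.
transitivity ((c *m F) 0 0).
  rewrite mxE; apply: eq_bigr => i _; congr (_ * _); rewrite mxE.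
  by rewrite (rkhs_sym rkhs (HK i) Hf) (rkhs_reproducing rkhs).
rewrite /c -mulmxA mxE; apply: eq_bigr => l _.
by rewrite [X in X * _]mxE mulrAC.
Qed.

Section NormalEquation.
Variables (lam : R) (N : nat) (S : {set 'I_N}) (z : 'I_N -> X * R) (g : X -> R).
Hypotheses (lam_gt0 : 0 < lam) (gmin : is_krr_estimate H ip lam S z g).

Let Hg : H g. Proof. by case: gmin. Qed.

(** First-order condition: along the line [g + e h] the objective is a quadratic
    polynomial in [e], minimal at [e = 0]. *)
Lemma krr_normal_equation (h : X -> R) : H h ->
  #|S|%:R^-1 * \sum_(j in S) (g (z j).1 - (z j).2) * h (z j).1 + lam * ip g h = 0.
Proof.
move=> Hh; set L := _ + _.
pose Q := #|S|%:R^-1 * \sum_(j in S) h (z j).1 ^+ 2 + lam * ip h h.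
have Q0 : 0 <= Q.
  apply: addr_ge0; apply: mulr_ge0; rewrite ?invr_ge0 ?(ltW lam_gt0)//.
    by apply: sumr_ge0 => j _; exact: sqr_ge0.
  exact: (rkhs_ge0 rkhs).
have quad e : 0 <= 2 * e * L + e ^+ 2 * Q.
  have Heg : H (e *: h + g) by exact: (rkhs_closed rkhs).
  have ipE : ip (e *: h + g) (e *: h + g) = ip g g + 2 * e * ip g h + e ^+ 2 * ip h h.
    rewrite (rkhs_linear rkhs)// (rkhs_sym rkhs Hh Heg) (rkhs_sym rkhs Hg Heg).
    by rewrite !(rkhs_linear rkhs)// (rkhs_sym rkhs Hh Hg); ring.
  have [_ /(_ _ Heg)] := gmin.
  rewrite /krr_objective ipE -subr_ge0; congr (_ <= _).
  have -> : \sum_(j in S) ((e *: h + g) (z j).1 - (z j).2) ^+ 2 =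
     \sum_(j in S) (g (z j).1 - (z j).2) ^+ 2 +
     2 * e * (\sum_(j in S) (g (z j).1 - (z j).2) * h (z j).1) +
     e ^+ 2 * \sum_(j in S) h (z j).1 ^+ 2.
    rewrite !mulr_sumr -!big_split; apply: eq_bigr => j _ /=.
    rewrite (_ : (e *: h + g) (z j).1 = e * h (z j).1 + g (z j).1)//; ring.
  rewrite /L /Q; ring.
have Q1 : 0 < Q + 1 by rewrite ltr_wpDl.
(* The vertex would be at - L / Q; adding 1 covers the case Q = 0. *)
have := quad (- L / (Q + 1)).
have -> : 2 * (- L / (Q + 1)) * L + (- L / (Q + 1)) ^+ 2 * Q =
   - (L ^+ 2 * ((Q + 2) / (Q + 1) ^+ 2)) by field; rewrite gt_eqF.
rewrite oppr_ge0 pmulr_lle0; last by rewrite divr_gt0 ?exprn_gt0//; lra.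
by move=> L0; apply/eqP; rewrite -sqrf_eq0 eq_le L0 sqr_ge0.
Qed.

Hypothesis mu_gt0 : forall l, 0 < mu l.
Variables (fstar : X -> R) (b : 'I_q -> R).
Hypothesis fstarE : forall x, fstar x = \sum_l mu l * b l * phi l x.

Let feat x : 'cV[R]_q := \col_l phi l x.
Let A := ridge_mx S lam (fun l => (mu l)^-1) (fun k => feat (z k).1).

(** Testing the first-order condition on the kernel sections expresses [g] as a
    combination of the eigenfunctions; comparing coefficients with [fstar] and
    dividing by the eigenvalues gives the linear system for [delta]. *)
Lemma krr_error : A \in unitmx ->
  let delta := invmx A *m
    (#|S|%:R^-1 *: (\sum_(k in S) ((z k).2 - fstar (z k).1) *: feat (z k).1) -
     lam *: \col_l b l) in
  forall x, g x - fstar x = \sum_l delta l 0 * phi l x.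
Proof.
move=> Au delta.
pose rho l := #|S|%:R^-1 * \sum_(j in S) ((z j).2 - g (z j).1) * phi l (z j).1.
pose d : 'cV[R]_q := \col_l (lam^-1 * mu l * rho l - mu l * b l).
have lamN0 : lam != 0 by rewrite gt_eqF.
have gE x : g x = \sum_l (lam^-1 * mu l * rho l) * phi l x.
  have := krr_normal_equation (rkhs_kernel rkhs x).
  rewrite (rkhs_reproducing rkhs)// => /eqP; rewrite addrC addr_eq0 => /eqP E.
  apply: (mulfI lamN0); rewrite E -mulrN -sumrN mulr_sumr mulr_sumr.
  under eq_bigr do rewrite K_sum -mulNr opprB !mulr_sumr.
  rewrite exchange_big /=; apply: eq_bigr => l _.
  rewrite /rho !(mulr_sumr, mulr_suml); apply: eq_bigr => j _.
  by move: (#|S|%:R^-1) => c; field.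
have gd t : g t - fstar t = \sum_l d l 0 * phi l t.
  rewrite gE fstarE -sumrB; apply: eq_bigr => l _; rewrite mxE; ring.
have resid j : (z j).2 - g (z j).1 =
    (z j).2 - fstar (z j).1 - dot (feat (z j).1) d.
  rewrite /dot; under eq_bigr do rewrite mulrC [X in _ * X]mxE.
  by rewrite -gd; ring.
suff -> : delta = d by [].
rewrite /delta; apply: (canLR (mulKmx Au)).
rewrite /A /ridge_mx mulmxDl -!scalemxAl mulmx_suml mul_diag_mx.
have -> : \sum_(k in S) feat (z k).1 *m (feat (z k).1)^T *m d =
    \sum_(k in S) dot (feat (z k).1) d *: feat (z k).1.
  apply: eq_bigr => k _; rewrite -mulmxA; apply/colP => l.
  rewrite !mxE big_ord1 mulrC [X in _ * X]mxE; congr (_ * _).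
  by rewrite mxE; apply: eq_bigr => i _; rewrite !mxE.
apply/colP => l; rewrite !(mxE, summxE).
have -> : \sum_(k in S) (((z k).2 - fstar (z k).1) *: feat (z k).1) l 0 =
  \sum_(k in S) ((z k).2 - g (z k).1) * phi l (z k).1 +
  \sum_(k in S) (dot (feat (z k).1) d *: feat (z k).1) l 0.
  rewrite -big_split /=; apply: eq_bigr => k _; rewrite resid !mxE; ring.
have mN0 : mu l != 0 by rewrite gt_eqF.
rewrite /rho; move: (#|S|%:R^-1) => c; field.
by rewrite lamN0 mN0.
Qed.

End NormalEquation.
End FiniteRank.

(** * Concentration of the empirical second moments *)

Lemma expR_le_quadratic (R : realType) (x : R) : `|x| <= 2^-1 ->
  expR x <= 1 + x + 2 * x ^+ 2.
Proof.
(* exp x <= 1 / (1 - x), and (1 + x + 2 x^2) (1 - x) = 1 + x^2 (1 - 2 x) >= 1 *)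
rewrite ler_norml => /andP[x1 x2].
have h := expR_ge1Dx (- x).
have h0 : 0 < expR (- x) by exact: expR_gt0.
rewrite -[expR x]invrK -expRN -div1r ler_pdivrMr//.
have : 1 <= (1 + x + 2 * x ^+ 2) * (1 - x).
  have : 0 <= x ^+ 2 * (1 - 2 * x) by apply: mulr_ge0; [exact: sqr_ge0|lra].
  rewrite expr2; lra.
move=> /le_trans; apply; rewrite ler_wpM2l//.
have := sqr_ge0 x; lra.
Qed.

Section Mgf.
Context {d : measure_display} {T : measurableType d} {R : realType}.
Variables (P : probability T R) (g : T -> R) (M b s t : R).
Hypotheses (mg : measurable_fun setT g) (gb : forall x, `|g x| <= b)
  (gM : (\int[P]_x (g x)%:E = M%:E)%E) (s_ge0 : 0 <= s) (sb : 4 * b * s <= 1).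

Let b_ge0 : 0 <= b. Proof. exact: le_trans (gb point). Qed.

Let g_integrable : P.-integrable setT (EFin \o g).
Proof. exact: bounded_integrable gb. Qed.

Let M_le : `|M| <= b.
Proof.
rewrite -lee_fin -abse_EFin -gM.
apply: le_trans (le_abse_integral P measurableT _) _.
  by apply/measurable_EFinP.
rewrite -[leRHS]mule1 -(@probability_setT _ _ _ P) -integral_cst//.
apply: ge0_le_integral => //.
- by apply/measurable_EFinP; exact: measurableT_comp.
- by move=> x _; rewrite lee_fin.
Qed.

Lemma mgf_centered_le :
  (\int[P]_x (expR (s * (g x - M) - s * t))%:E <=
   (expR (8 * b ^+ 2 * s ^+ 2 - s * t))%:E)%E.
Proof.
have small x : `|s * (g x - M)| <= 2^-1.
  rewrite normrM (ger0_norm s_ge0).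
  have : `|g x - M| <= 2 * b.
    by apply: le_trans (ler_normB _ _) _; have := gb x; have := M_le; lra.
  move=> /(ler_wpM2l s_ge0) /le_trans; apply.
  rewrite (_ : s * (2 * b) = 2^-1 * (4 * b * s)); last by field.
  by rewrite -[leRHS]mulr1 ler_pM2l ?invr_gt0.
have sq x : (s * (g x - M)) ^+ 2 <= 4 * b ^+ 2 * s ^+ 2.
  have : `|g x - M| <= 2 * b.
    by apply: le_trans (ler_normB _ _) _; have := gb x; have := M_le; lra.
  move=> h; rewrite exprMn [leLHS]mulrC; apply: ler_wpM2r; first exact: sqr_ge0.
  rewrite -(real_normK (num_real _)) (_ : 4 * b ^+ 2 = (2 * b) ^+ 2).
    by rewrite lerXn2r ?nnegrE// mulr_ge0.
  by rewrite exprMn; congr (_ * _); rewrite expr2; lra.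
pose C := 1 + 8 * b ^+ 2 * s ^+ 2 - s * M.
have up x : expR (s * (g x - M) - s * t) <= expR (- (s * t)) * (s * g x + C).
  rewrite expRD mulrC ler_wpM2l ?expR_ge0//.
  apply: le_trans (expR_le_quadratic (small x)) _; have := sq x; rewrite /C; lra.
have mex : measurable_fun setT (fun x => expR (s * (g x - M) - s * t)).
  apply: (measurableT_comp (@measurable_expR R)); apply: measurable_funB => //.
  by apply: measurable_funM => //; exact: measurable_funB.
have ilin : P.-integrable setT (fun x => (s * g x + C)%:E).
  have i1 := integrableZl measurableT s g_integrable.
  have i2 := finite_measure_integrable_cst P C measurableT.
  by have := integrableD measurableT i1 i2; apply: eq_integrable.
apply: (@le_trans _ _ (\int[P]_x ((expR (- (s * t)))%:E * (s * g x + C)%:E))%E).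
  apply: le_integral => //.
  - apply: (@le_integrable _ _ _ _ _ measurableT _
      (fun x => ((expR (- (s * t)))%:E * (s * g x + C)%:E)%E)) => //.
    + exact/measurable_EFinP.
    + move=> x _; rewrite -EFinM !abse_EFin lee_fin.
      apply: le_trans (ler_norm _); rewrite ger0_norm ?expR_ge0//.
    + exact: integrableZl.
  - exact: integrableZl.
  - by move=> x _; rewrite -EFinM lee_fin.
rewrite integralZl//.
have -> : (\int[P]_x (s * g x + C)%:E = (1 + 8 * b ^+ 2 * s ^+ 2)%:E)%E.
  under eq_integral do rewrite EFinD EFinM.
  rewrite integralD//.
  - rewrite integralZl// gM integral_cst// [X in (_ + _ * X)%E](@probability_setT _ _ _ P).
    by rewrite mule1 -EFinM -EFinD /C; congr _%:E; ring.
  - exact: integrableZl.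
  - exact: finite_measure_integrable_cst.
rewrite -EFinM lee_fin (addrC _ (- (s * t))) expRD ler_wpM2l ?expR_ge0//.
exact: expR_ge1Dx.
Qed.

End Mgf.

Section Concentration.
Context {d : measure_display} {X : measurableType d} {R : realType} {q : nat}.
Variables (P : probability (X * R)%type R) (phi : 'I_q -> X -> R) (w : X -> R)
  (M : 'I_q -> 'I_q -> R) (b : R) (r : nat).
Hypotheses (mphi : forall l, measurable_fun setT (phi l))
  (mw : measurable_fun setT w) (w01 : forall x, 0 <= w x <= 1)
  (gb : forall l l' x, `|w x * phi l x * phi l' x| <= b)
  (gM : forall l l',
    (\int[P]_z (w z.1 * phi l z.1 * phi l' z.1)%:E = (M l l')%:E)%E)
  (M_near : forall l l', `|M l l' - (l == l')%:R| <= (4 * r%:R)^-1)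
  (b_ge1 : 1 <= b) (qr : (q <= r)%N) (r_gt0 : (0 < r)%N).

Definition features (x : X) : 'cV[R]_q := \col_l phi l x.

(* The threshold t for the deviation of an entry is half of the total error
   1/(2r) allowed in [second_moment_ge_half]; s = t / (16 b^2) minimises 8 b^2 s^2 - s t, and the
   minimum is - [bad_rate]. *)
Let s : R := (64 * r%:R * b ^+ 2)^-1.
Let t : R := (4 * r%:R)^-1.
Definition bad_rate : R := (512 * r%:R ^+ 2 * b ^+ 2)^-1.

Let r0 : 0 < r%:R :> R. Proof. by rewrite ltr0n. Qed.
Let b0 : 0 < b. Proof. exact: lt_le_trans b_ge1. Qed.

Let s_gt0 : 0 < s.
Proof. by rewrite invr_gt0 !mulr_gt0// exprn_gt0. Qed.

Let rate_eq : 8 * b ^+ 2 * s ^+ 2 - s * t = - bad_rate.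
Proof. by rewrite /s /t /bad_rate; field; rewrite !gt_eqF. Qed.

Let sb : 4 * b * s <= 1.
Proof.
rewrite /s ler_pdivrMr ?mulr_gt0 ?exprn_gt0// mul1r.
have r1 : 1 <= r%:R :> R by rewrite ler1n.
have : b <= r%:R * b ^+ 2.
  by rewrite expr2 mulrA ler_peMl ?(ltW b0)// mulr_ege1.
have := b0; rewrite -(mulrA 64); lra.
Qed.

Let up l l' (x : X) := s * (w x * phi l x * phi l' x - M l l') - s * t.
Let down l l' (x : X) := s * (- (w x * phi l x * phi l' x) - - M l l') - s * t.

(** A majorant of the indicator that some entry of the weighted empirical second
    moment matrix of the block deviates by more than [1 / (4 r)] from its mean: the
    sum of the exponentials of Markov's inequality.  Unlike the indicator it is
    given by a formula whose integral is bounded directly. *)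
Definition bad_bound (N : nat) (S : {set 'I_N}) (x : 'I_N -> X) : R :=
  \sum_l \sum_l' (expR (\sum_(k in S) up l l' (x k)) +
                  expR (\sum_(k in S) down l l' (x k))).

Let mg l l' : measurable_fun setT (fun x => w x * phi l x * phi l' x).
Proof. by apply: measurable_funM => //; exact: measurable_funM. Qed.

Let mup l l' : measurable_fun setT (up l l').
Proof.
by apply: measurable_funB => //; apply: measurable_funM => //; exact: measurable_funB.
Qed.

Let mdown l l' : measurable_fun setT (down l l').
Proof.
apply: measurable_funB => //; apply: measurable_funM => //.
by apply: measurable_funB => //; exact: measurableT_comp.
Qed.

Let mexp (N : nat) (S : {set 'I_N}) (h : X -> R) : measurable_fun setT h ->
  jointly_measurable (fun x : 'I_N -> X => expR (\sum_(k in S) h (x k))).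
Proof.
move=> mh d' T z mz; apply: (measurableT_comp (@measurable_expR R)).
apply: (@jointly_measurable_sum _ _ R N _ (fun k => k \in S) (fun k x => h (x k)) _ _
  T z) => // k.
exact: jointly_measurable_coord.
Qed.

Lemma bad_bound_ge0 N (S : {set 'I_N}) x : 0 <= bad_bound S x.
Proof.
apply: sumr_ge0 => l _; apply: sumr_ge0 => l' _.
by rewrite addr_ge0 ?expR_ge0.
Qed.

Lemma bad_bound_measurable N (S : {set 'I_N}) : jointly_measurable (bad_bound S).
Proof.
apply: jointly_measurable_sum => l; apply: jointly_measurable_sum => l'.
by move=> d' T z mz; apply: measurable_funD; exact: mexp.
Qed.

Let le_bad N (S : {set 'I_N}) x l l' :
  expR (\sum_(k in S) up l l' (x k)) + expR (\sum_(k in S) down l l' (x k)) <=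
  bad_bound S x.
Proof.
rewrite /bad_bound (bigD1 l)//= (bigD1 l')//= -[leLHS]addr0 -[leLHS]addr0.
have nn i j : 0 <= expR (\sum_(k in S) up i j (x k)) + expR (\sum_(k in S) down i j (x k)).
  by rewrite addr_ge0 ?expR_ge0.
apply: lerD; first by apply: lerD => //; exact: sumr_ge0.
by apply: sumr_ge0 => i _; exact: sumr_ge0.
Qed.

Lemma bad_or_well_conditioned N (S : {set 'I_N}) (x : 'I_N -> X) :
  (0 < #|S|)%N -> 1 <= bad_bound S x \/
  forall v, 2^-1 * dot v v <= second_moment S (fun k => features (x k)) v.
Proof.
move=> S0; have n0 : 0 < #|S|%:R :> R by rewrite ltr0n.
have sumC (c : R) : \sum_(k in S) c = #|S|%:R * c by rewrite sumr_const mulr_natl.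
pose G l l' := \sum_(k in S) w (x k) * phi l (x k) * phi l' (x k).
have [/forallP h|] := boolP [forall l, [forall l', `|#|S|%:R^-1 * G l l' - M l l'| <= t]].
  right; apply: (@second_moment_ge_half _ _ _ r S _ (fun k => w (x k)) M) => //.
  move=> l l'; have /forallP := h l; move=> /(_ l'); apply: le_trans.
  rewrite le_eqVlt; apply/orP; left; apply/eqP; congr `|_ * _ - _|.
  by apply: eq_bigr => k _; rewrite !mxE.
rewrite negb_forall => /existsP[l]; rewrite negb_forall => /existsP[l'].
rewrite -ltNge lter_normr => /orP[] h; left; apply: le_trans (le_bad S x l l').
- rewrite ler_wpDr ?expR_ge0// -expR0 ler_expR.
  rewrite /up sumrB -mulr_sumr sumrB -/(G l l') !sumC.
  rewrite (_ : _ - _ = s * #|S|%:R * (#|S|%:R^-1 * G l l' - M l l' - t)).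
    by rewrite mulr_ge0 ?subr_ge0 ?ltW// mulr_gt0.
  by field; rewrite gt_eqF.
- rewrite ler_wpDl ?expR_ge0// -expR0 ler_expR.
  rewrite /down sumrB -mulr_sumr sumrB sumrN -/(G l l') !sumC.
  rewrite (_ : _ - _ = s * #|S|%:R * (- (#|S|%:R^-1 * G l l' - M l l') - t)).
    by rewrite mulr_ge0 ?subr_ge0 ?ltW// mulr_gt0.
  by field; rewrite gt_eqF.
Qed.

Section Integral.
Context {dO : measure_display} {Om : measurableType dO} {N : nat}.
Variables (nu : {finite_measure set Om -> \bar R}) (Z : 'I_N -> Om -> X * R).
Hypothesis mZ : forall k, measurable_fun setT (Z k).
Hypothesis indepZ : forall B : 'I_N -> set (X * R),
  (forall k, measurable (B k)) ->
  nu [set w | forall k, B k (Z k w)] = (nu setT * \prod_(k < N) P (B k))%E.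

Lemma integral_bad_bound_le (S : {set 'I_N}) :
  (\int[nu]_o (bad_bound S (fun k => (Z k o).1))%:E <=
   (2 * q%:R ^+ 2 * expR (- (bad_rate * #|S|%:R)))%:E * nu setT)%E.
Proof.
have kap : expR (- bad_rate) ^+ #|S| = expR (- (bad_rate * #|S|%:R)).
  by rewrite -expRM_natl; congr expR; ring.
have intup l l' : (\int[nu]_o (expR (\sum_(k in S) up l l' (Z k o).1))%:E <=
    (expR (- (bad_rate * #|S|%:R)))%:E * nu setT)%E.
  rewrite -kap.
  apply: (@integral_expR_sum_le _ _ _ _ R N P nu Z mZ indepZ (fun z => up l l' z.1)).
  - exact: measurableT_comp.
  - exact: expR_ge0.
  - rewrite -rate_eq.
    apply: (@mgf_centered_le _ _ _ P (fun z => w z.1 * phi l z.1 * phi l' z.1)) => //.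
    + exact: (measurableT_comp (mg l l')).
    + exact: ltW.
have intdown l l' : (\int[nu]_o (expR (\sum_(k in S) down l l' (Z k o).1))%:E <=
    (expR (- (bad_rate * #|S|%:R)))%:E * nu setT)%E.
  rewrite -kap.
  apply: (@integral_expR_sum_le _ _ _ _ R N P nu Z mZ indepZ (fun z => down l l' z.1)).
  - exact: measurableT_comp.
  - exact: expR_ge0.
  - rewrite -rate_eq.
    apply: (@mgf_centered_le _ _ _ P (fun z => - (w z.1 * phi l z.1 * phi l' z.1))) => //.
    + by apply: measurableT_comp => //; exact: (measurableT_comp (mg l l')).
    + by move=> x; rewrite normrN.
    + under eq_integral do rewrite EFinN -mulN1e.
      rewrite integralZl// ?gM ?mulN1e//.
      apply: (bounded_integrable P (f := fun z => w z.1 * phi l z.1 * phi l' z.1)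
        (b := b)) => //.
      exact: (measurableT_comp (mg l l')).
    + exact: ltW.
have mcomp (F : ('I_N -> X) -> R) : jointly_measurable F ->
    measurable_fun setT (fun o => F (fun k => (Z k o).1)).
  move=> mF; apply: (mF _ _ (fun k o => (Z k o).1)) => k.
  exact: (measurableT_comp measurable_fst).
have nuT : nu setT = (fine (nu setT))%:E by rewrite fineK// fin_num_measure.
set E := expR (- (bad_rate * _)) in intup intdown *.
have mU l l' : measurable_fun setT
    (fun o => expR (\sum_(k in S) up l l' (Z k o).1)).
  by apply: (mcomp (fun x => expR (\sum_(k in S) up l l' (x k)))); exact: mexp.
have mD l l' : measurable_fun setT
    (fun o => expR (\sum_(k in S) down l l' (Z k o).1)).
  by apply: (mcomp (fun x => expR (\sum_(k in S) down l l' (x k)))); exact: mexp.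
have -> : (\int[nu]_o (bad_bound S (fun k => (Z k o).1))%:E =
    \sum_l \sum_l' (\int[nu]_o (expR (\sum_(k in S) up l l' (Z k o).1))%:E +
      \int[nu]_o (expR (\sum_(k in S) down l l' (Z k o).1))%:E))%E.
  rewrite /bad_bound; under eq_integral do rewrite -sumEFin.
  rewrite ge0_integral_sum//.
  - apply: eq_bigr => l _; under eq_integral do rewrite -sumEFin.
    rewrite ge0_integral_sum//.
    + apply: eq_bigr => l' _; under eq_integral do rewrite EFinD.
      by rewrite ge0_integralD//; (try by move=> o _; rewrite lee_fin expR_ge0);
        exact/measurable_EFinP.
    + by move=> l'; apply/measurable_EFinP; exact: measurable_funD.
  - move=> l; apply/measurable_EFinP; apply: measurable_sum => l'.
    exact: measurable_funD.
  - move=> l o _; rewrite lee_fin; apply: sumr_ge0 => l' _.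
    by rewrite addr_ge0 ?expR_ge0.
apply: (@le_trans _ _ (\sum_(l < q) \sum_(l' < q) (E%:E * nu setT + E%:E * nu setT))%E).
  by apply: lee_sum => l _; apply: lee_sum => l' _; exact: leeD.
rewrite nuT -!EFinM -EFinD.
rewrite (eq_bigr (fun=> (q%:R * (E * fine (nu setT) + E * fine (nu setT)))%:E)).
  rewrite sumEFin lee_fin sumr_const card_ord -[_ *+ q]mulr_natl.
  by rewrite le_eqVlt; apply/orP; left; apply/eqP; ring.
by move=> l _; rewrite sumEFin sumr_const card_ord -[_ *+ q]mulr_natl.
Qed.
End Integral.
End Concentration.

(** * Measurability of the inverse of a random matrix *)

Section MeasurableInverse.
Context {dT : measure_display} {T : measurableType dT} {R : realType} {N : nat}.
Implicit Types F G : ('I_N -> T) -> R.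

Lemma measurable_funV (d : measure_display) (S : measurableType d) (f : S -> R) :
  measurable_fun setT f -> measurable_fun setT (fun x => (f x)^-1).
Proof.
move=> mf.
have -> : (fun x => (f x)^-1) = (fun x => f x * ((f x ^+ 2) `^ (-1))).
  apply/funext => x; rewrite powR_inv1 ?sqr_ge0//.
  have [->|f0] := eqVneq (f x) 0; first by rewrite mul0r invr0.
  by rewrite expr2 invfM mulrA mulfV// mul1r.
apply: measurable_funM => //.
apply: (measurableT_comp (@measurable_powR R (-1))).
exact: measurable_funX.
Qed.

Lemma jointly_measurable_mul F G : jointly_measurable F -> jointly_measurable G ->
  jointly_measurable (fun z => F z * G z).
Proof. by move=> mF mG d S z mz; apply: measurable_funM; [exact: mF|exact: mG]. Qed.

Lemma jointly_measurable_inv F : jointly_measurable F ->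
  jointly_measurable (fun z => (F z)^-1).
Proof. by move=> mF d S z mz; apply: measurable_funV; exact: mF. Qed.

Lemma jointly_measurable_cst c : jointly_measurable (fun _ : 'I_N -> T => c : R).
Proof. by move=> d S z mz; exact: measurable_cst. Qed.

Lemma jointly_measurable_add F G : jointly_measurable F -> jointly_measurable G ->
  jointly_measurable (fun z => F z + G z).
Proof. by move=> mF mG d S z mz; apply: measurable_funD; [exact: mF|exact: mG]. Qed.

Lemma jointly_measurable_det (q : nat) (A : ('I_N -> T) -> 'M[R]_q) :
  (forall i j, jointly_measurable (fun z => A z i j)) ->
  jointly_measurable (fun z => \det (A z)).
Proof.
move=> mA; apply: jointly_measurable_sum => s.
apply: jointly_measurable_mul; first exact: jointly_measurable_cst.
by move=> d S z mz; apply: measurable_prod => i _; exact: mA.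
Qed.

Lemma jointly_measurable_invmx (q : nat) (A : ('I_N -> T) -> 'M[R]_q)
    (u : ('I_N -> T) -> 'cV[R]_q) (l : 'I_q) :
  (forall i j, jointly_measurable (fun z => A z i j)) ->
  (forall i, jointly_measurable (fun z => u z i 0)) ->
  (forall z, A z \in unitmx) ->
  jointly_measurable (fun z => (invmx (A z) *m u z) l 0).
Proof.
move=> mA mu Au.
have -> : (fun z => (invmx (A z) *m u z) l 0) =
    (fun z => \sum_i ((\det (A z))^-1 * cofactor (A z) i l) * u z i 0).
  apply/funext => z; rewrite mxE; apply: eq_bigr => i _.
  by rewrite /invmx Au !mxE.
apply: jointly_measurable_sum => i.
apply: jointly_measurable_mul => //; apply: jointly_measurable_mul.
  by apply: jointly_measurable_inv; exact: jointly_measurable_det.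
apply: jointly_measurable_mul; first exact: jointly_measurable_cst.
apply: jointly_measurable_det => i' j'.
have -> : (fun z => row' i (col' l (A z)) i' j') =
    (fun z => A z (lift i i') (lift l j')).
  by apply/funext => z; rewrite !mxE.
exact: mA.
Qed.

End MeasurableInverse.

(** Bounds are proportional to the mass of [nu], so that they can be summed over
    the possible splits. *)
Record mean_le {d : measure_display} {T : measurableType d} {R : realType}
    (nu : {finite_measure set T -> \bar R}) (F : T -> R) (c : R) : Prop := {
  mean_le_meas : measurable_fun setT F ;
  mean_le_ge0 : forall x, 0 <= F x ;
  mean_leP : (\int[nu]_x (F x)%:E <= c%:E * nu setT)%E }.

Section MeanLe.
Context {d : measure_display} {T : measurableType d} {R : realType}.
Variable nu : {finite_measure set T -> \bar R}.
Implicit Types F G : T -> R.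

Let mass : {c : R | 0 <= c & nu setT = c%:E}.
Proof.
exists (fine (nu setT)); first exact: fine_ge0.
by rewrite fineK// fin_num_measure.
Qed.

Lemma mean_le_cst c : 0 <= c -> mean_le nu (fun=> c) c.
Proof. by move=> c0; split => //; rewrite integral_cst. Qed.

Lemma mean_leD F G a b : mean_le nu F a -> mean_le nu G b ->
  mean_le nu (fun x => F x + G x) (a + b).
Proof.
move=> [mF F0 Fa] [mG G0 Gb]; split.
- exact: measurable_funD.
- by move=> x; rewrite addr_ge0.
- under eq_integral do rewrite EFinD.
  rewrite ge0_integralD//; try (by move=> x _; rewrite lee_fin);
    try exact/measurable_EFinP.
  have [c _ nuc] := mass; rewrite nuc in Fa Gb *.
  by rewrite EFinD muleDl//; exact: leeD.
Qed.

Lemma mean_leZ F a k : 0 <= k -> mean_le nu F a ->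
  mean_le nu (fun x => k * F x) (k * a).
Proof.
move=> k0 [mF F0 Fa]; split.
- exact: measurable_funM.
- by move=> x; rewrite mulr_ge0.
- under eq_integral do rewrite EFinM.
  rewrite ge0_integralZl_EFin//; try (by move=> x _; rewrite lee_fin);
    try exact/measurable_EFinP.
  by rewrite EFinM -muleA; exact: lee_wpmul2l.
Qed.

Lemma mean_le_sum (I : finType) (F : I -> T -> R) (a : I -> R) :
  (forall i, mean_le nu (F i) (a i)) ->
  mean_le nu (fun x => \sum_i F i x) (\sum_i a i).
Proof.
move=> h.
have -> : (fun x => \sum_i F i x) = \sum_i F i by apply/funext => x; rewrite fct_sumE.
elim/big_rec2: _ => [|i y1 y2 _ IH]; first exact: (mean_le_cst (lexx 0)).
exact: mean_leD.
Qed.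

Lemma le_mean_le F G a b : (forall x, F x <= G x) -> measurable_fun setT F ->
  (forall x, 0 <= F x) -> a <= b -> mean_le nu G a -> mean_le nu F b.
Proof.
move=> FG mF F0 ab [mG G0 Ga]; split => //.
apply: (@le_trans _ _ (\int[nu]_x (G x)%:E)%E).
  apply: ge0_le_integral => //.
  - by move=> x _; rewrite lee_fin.
  - exact/measurable_EFinP.
  - exact/measurable_EFinP.
  - by move=> x _; rewrite lee_fin.
by apply: le_trans Ga _; apply: lee_wpmul2r.
Qed.

End MeanLe.

(** * Risk for a given split *)

Lemma sqr_sum_le (R : realType) (m : nat) (x : 'I_m -> R) :
  (\sum_i x i) ^+ 2 <= m%:R * \sum_i x i ^+ 2.
Proof.
have : 0 <= \sum_i \sum_j (x i - x j) ^+ 2.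
  by apply: sumr_ge0 => i _; apply: sumr_ge0 => j _; exact: sqr_ge0.
have inner i : \sum_j (x i - x j) ^+ 2 =
    m%:R * x i ^+ 2 - 2 * x i * \sum_j x j + \sum_j x j ^+ 2.
  rewrite (eq_bigr (fun j => x i ^+ 2 - 2 * x i * x j + x j ^+ 2)); last first.
    by move=> j _; ring.
  by rewrite big_split sumrB /= sumr_const card_ord -mulr_sumr -[_ *+ m]mulr_natl.
rewrite (eq_bigr _ (fun i _ => inner i)) big_split /= sumrB -mulr_suml -!mulr_sumr.
rewrite sumr_const card_ord -[_ *+ m]mulr_natl expr2; lra.
Qed.

Section Risk.
Context {d : measure_display} {X : measurableType d} {R : realType} {q : nat}.
Variables (P : probability (X * R)%type R) (phi : 'I_q -> X -> R)
  (imu beta : 'I_q -> R) (kap : R) (fstar v : X -> R) (sigma : R)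
  (w : X -> R) (M : 'I_q -> 'I_q -> R) (b : R) (r : nat).
Hypotheses (mphi : forall l, measurable_fun setT (phi l))
  (phi2 : forall l, (\int[P]_z (phi l z.1 ^+ 2)%:E <= 1)%E)
  (mw : measurable_fun setT w) (w01 : forall x, 0 <= w x <= 1)
  (gb : forall l l' x, `|w x * phi l x * phi l' x| <= b)
  (gM : forall l l',
    (\int[P]_z (w z.1 * phi l z.1 * phi l' z.1)%:E = (M l l')%:E)%E)
  (M_near : forall l l', `|M l l' - (l == l')%:R| <= (4 * r%:R)^-1)
  (b_ge1 : 1 <= b) (qr : (q <= r)%N) (r_gt0 : (0 < r)%N).
Hypotheses (kap_gt0 : 0 < kap) (imu_ge : forall l, kap^-1 <= imu l).
Hypotheses (hmean : is_cond_exp P snd fstar)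
  (hvar : is_cond_exp P (fun z => (z.2 - fstar z.1) ^+ 2) v)
  (hv : forall x, v x <= sigma ^+ 2).

Context {dO : measure_display} {Om : measurableType dO} {N m : nat}.
Variables (nu : {finite_measure set Om -> \bar R}) (Z : 'I_N -> Om -> X * R)
  (t : {ffun 'I_N -> 'I_m}) (n : nat).
Hypothesis mZ : forall k, measurable_fun setT (Z k).
Hypothesis indepZ : forall B : 'I_N -> set (X * R),
  (forall k, measurable (B k)) ->
  nu [set w | forall k, B k (Z k w)] = (nu setT * \prod_(k < N) P (B k))%E.
Hypotheses (N_gt0 : (0 < N)%N) (m_gt0 : (0 < m)%N) (Nnm : N = (n * m)%N)
  (card_block : forall i, #|block t i| = n).

Let lam : R := r%:R / N%:R.

Let bvec : 'cV[R]_q := \col_l beta l.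

Let A (i : 'I_m) (x : 'I_N -> X) : 'M[R]_q :=
  ridge_mx (block t i) lam imu (fun k => features phi (x k)).

(** The solution of the linear system of [krr_error], as a function of the
    sample. *)
Definition block_error (z : 'I_N -> X * R) (i : 'I_m) : 'cV[R]_q :=
  invmx (A i (fun k => (z k).1)) *m
    (#|block t i|%:R^-1 *: (\sum_(k in block t i)
       ((z k).2 - fstar (z k).1) *: features phi (z k).1) - lam *: bvec).

Definition average_error z : 'cV[R]_q := m%:R^-1 *: \sum_i block_error z i.

Let n_gt0 : (0 < n)%N.
Proof. by move: N_gt0; rewrite Nnm muln_gt0 => /andP[]. Qed.

Let lam_gt0 : 0 < lam.
Proof. by rewrite divr_gt0 ?ltr0n. Qed.

Let a (k : 'I_N) (x : 'I_N -> X) : 'cV[R]_q :=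
  invmx (A (t k) x) *m features phi (x k).

Let bad i (x : 'I_N -> X) : R := bad_bound phi w M b r (block t i) x.

Let A_unit i x : A i x \in unitmx.
Proof. exact: ridge_unitmx lam_gt0 kap_gt0 imu_ge. Qed.

Let good_or_bad i x : 1 <= bad i x \/
  forall u, 2^-1 * dot u u <= second_moment (block t i) (fun k => features phi (x k)) u.
Proof.
apply: (bad_or_well_conditioned phi w01 M_near b_ge1 qr r_gt0).
by rewrite card_block.
Qed.

Let mem_own_block k : k \in block t (t k).
Proof. by rewrite inE. Qed.

Let a_bound k x : dot (a k x) (a k x) <= kap / lam * n%:R.
Proof.
rewrite -(card_block (t k)).
exact: (dot_ridge_inv_feature_le (fun k => features phi (x k)) lam_gt0
  kap_gt0 imu_ge (mem_own_block k)).
Qed.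

(* On the bad event the crude bound is absorbed since [bad] is at least 1. *)
Let a_le k x : dot (a k x) (a k x) <=
  4 * dot (features phi (x k)) (features phi (x k)) + kap / lam * n%:R * bad (t k) x.
Proof.
have bad0 := bad_bound_ge0 phi w M b r (block t (t k)) x.
have kl0 : 0 <= kap / lam * n%:R by rewrite mulr_ge0// divr_ge0 ?ltW.
case: (good_or_bad (t k) x) => [h|h].
- apply: (le_trans (a_bound k x)); rewrite ler_wpDl ?mulr_ge0 ?dot_ge0//.
  by rewrite ler_peMr.
- apply: ler_wpDr; first exact: mulr_ge0.
  exact: (dot_ridge_inv_le4 lam_gt0 kap_gt0 imu_ge _ h).
Qed.

Let bias i x := lam *: (invmx (A i x) *m bvec).

Let bias_le i x : dot (bias i x) (bias i x) <=
  (4 * lam ^+ 2 + kap ^+ 2 * bad i x) * dot bvec bvec.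
Proof.
have bad0 := bad_bound_ge0 phi w M b r (block t i) x.
rewrite /bias dotZr dotC dotZr mulrA -expr2.
have b0 := dot_ge0 bvec.
have l2 := sqr_ge0 lam.
case: (good_or_bad i x) => [h|h].
- have := dot_ridge_inv_le (block t i) (fun k => features phi (x k)) lam_gt0
    kap_gt0 imu_ge bvec.
  rewrite -/(A i x) => /(ler_wpM2l l2) /le_trans; apply.
  rewrite mulrA ler_wpM2r// -exprMn mulrCA divff ?gt_eqF// mulr1.
  by rewrite ler_wpDl ?mulr_ge0// ler_peMr ?sqr_ge0.
- have := dot_ridge_inv_le4 lam_gt0 kap_gt0 imu_ge bvec h.
  rewrite -/(A i x) => /(ler_wpM2l l2) /le_trans; apply.
  rewrite mulrA ler_wpM2r// (mulrC _ 4) lerDl mulr_ge0 ?sqr_ge0//.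
Qed.

Let block_errorE z i : block_error z i =
  n%:R^-1 *: (\sum_(k in block t i) noise fstar (z k) *: a k (fun i => (z i).1)) -
  bias i (fun k => (z k).1).
Proof.
rewrite /block_error mulmxBr -!scalemxAr mulmx_sumr card_block; congr (_ *: _ - _).
apply: eq_bigr => k; rewrite inE => /eqP tk.
by rewrite -scalemxAr /a tk.
Qed.

Let average_errorE z : average_error z =
  N%:R^-1 *: (\sum_k noise fstar (z k) *: a k (fun i => (z i).1)) -
  m%:R^-1 *: \sum_i bias i (fun k => (z k).1).
Proof.
rewrite /average_error (eq_bigr _ (fun i _ => block_errorE z i)) sumrB scalerBr.
congr (_ - _); rewrite -scaler_sumr scalerA.
have -> : N%:R^-1 = m%:R^-1 * n%:R^-1 :> R by rewrite Nnm natrM invfM mulrC.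
congr (_ *: _); rewrite [RHS](partition_big t predT)//=.
by apply: eq_bigr => i _; apply: eq_bigl => k; rewrite inE.
Qed.

Let upper (z : 'I_N -> X * R) : R :=
  2 * N%:R ^- 2 *
    (\sum_l (\sum_k noise fstar (z k) * a k (fun i => (z i).1) l 0) ^+ 2) +
  2 * m%:R^-1 * (\sum_i
    (4 * lam ^+ 2 + kap ^+ 2 * bad i (fun k => (z k).1)) * dot bvec bvec).

Let average_error_le z : dot (average_error z) (average_error z) <= upper z.
Proof.
rewrite average_errorE; set V := \sum_k _; set B := \sum_i _.
have h1 : dot (N%:R^-1 *: V - m%:R^-1 *: B) (N%:R^-1 *: V - m%:R^-1 *: B) <=
    2 * (N%:R ^- 2 * dot V V) + 2 * (m%:R ^- 2 * dot B B).
  rewrite /dot !mulr_sumr -big_split /=; apply: ler_sum => l _; rewrite !mxE.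
  rewrite -!exprVn -!expr2 -!exprMn.
  by have := sqr_ge0 (N%:R^-1 * V l 0 + m%:R^-1 * B l 0); lra.
apply: le_trans h1 _; apply: lerD.
  rewrite -mulrA ler_pM2l// ler_wpM2l ?invr_ge0 ?sqr_ge0//.
  apply: ler_sum => l _; rewrite -expr2 /V summxE le_eqVlt; apply/orP; left; apply/eqP.
  by congr (_ ^+ 2); apply: eq_bigr => k _; rewrite mxE.
rewrite -mulrA ler_pM2l//.
have mp : 0 < m%:R :> R by rewrite ltr0n.
have h2 : dot B B <= m%:R * \sum_i dot (bias i (fun k => (z k).1)) (bias i (fun k => (z k).1)).
  rewrite /dot exchange_big mulr_sumr; apply: ler_sum => l _.
  by rewrite -expr2 /B summxE; exact: sqr_sum_le.
have h3 : \sum_i dot (bias i (fun k => (z k).1)) (bias i (fun k => (z k).1)) <=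
  \sum_i (4 * lam ^+ 2 + kap ^+ 2 * bad i (fun k => (z k).1)) * dot bvec bvec.
  by apply: ler_sum => i _; exact: bias_le.
rewrite expr2 invfM -mulrA ler_pM2l ?invr_gt0// ler_pdivrMl//.
by apply: le_trans h2 _; rewrite ler_pM2l.
Qed.

Let noise_terms_measurable (k : 'I_N) (l : 'I_q) :
  jointly_measurable (fun x => a k x l 0).
Proof.
apply: jointly_measurable_invmx.
- move=> i j.
  have -> : (fun z => A (t k) z i j) = (fun z => #|block t (t k)|%:R^-1 *
      (\sum_(k' in block t (t k)) phi i (z k') * phi j (z k')) +
      lam * diag_mx (\row_l imu l) i j).
    apply/funext => z; rewrite !mxE summxE; congr (_ * _ + _).
    by apply: eq_bigr => k' _; rewrite !mxE big_ord1 !mxE.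
  apply: jointly_measurable_add; last exact: jointly_measurable_cst.
  apply: jointly_measurable_mul; first exact: jointly_measurable_cst.
  apply: jointly_measurable_sum => k'.
  by apply: jointly_measurable_mul; exact: jointly_measurable_coord.
- move=> i; have -> : (fun z : 'I_N -> X => features phi (z k) i 0) =
    (fun z => phi i (z k)) by apply/funext => z; rewrite mxE.
  exact: jointly_measurable_coord.
- by move=> z; exact: A_unit.
Qed.

Let tau : R := 2 * q%:R ^+ 2 * expR (- (bad_rate b r * n%:R)).

Let tau_ge0 : 0 <= tau.
Proof. by rewrite !mulr_ge0 ?expR_ge0// exprn_ge0. Qed.

Let mean_bad i : mean_le nu (fun o => bad i (fun k => (Z k o).1)) tau.
Proof.
split.
- apply: (bad_bound_measurable M b r mphi mw (block t i)
    (z := fun k o => (Z k o).1)) => k.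
  exact: (measurableT_comp measurable_fst).
- by move=> o; exact: bad_bound_ge0.
- rewrite /tau -(card_block i).
  exact: (integral_bad_bound_le mphi mw gb gM b_ge1 r_gt0 mZ indepZ).
Qed.

Let mean_features k : mean_le nu
  (fun o => dot (features phi (Z k o).1) (features phi (Z k o).1)) q%:R.
Proof.
have -> : q%:R = \sum_(l < q) (1 : R) by rewrite sumr_const card_ord.
have -> : (fun o => dot (features phi (Z k o).1) (features phi (Z k o).1)) =
    (fun o => \sum_l phi l (Z k o).1 ^+ 2).
  by apply/funext => o; apply: eq_bigr => l _; rewrite mxE.
apply: mean_le_sum => l; split.
- apply: measurable_funX; apply: (measurableT_comp (mphi l)).
  exact: (measurableT_comp measurable_fst).
- by move=> o; exact: sqr_ge0.
- apply: (@integral_coordinate_le _ _ _ _ _ _ P nu Z mZ indepZ k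
    (fun z => phi l z.1 ^+ 2)) => //.
  + by apply: measurable_funX; exact: (measurableT_comp (mphi l)).
  + by move=> z; exact: sqr_ge0.
Qed.

Let designZ (k : 'I_N) : measurable_fun setT (fun o => (Z k o).1).
Proof. exact: (measurableT_comp measurable_fst). Qed.

Let mean_a k : mean_le nu
  (fun o => dot (a k (fun i => (Z i o).1)) (a k (fun i => (Z i o).1)))
  (4 * q%:R + kap / lam * n%:R * tau).
Proof.
apply: (le_mean_le (fun o => a_le k (fun i => (Z i o).1))) (lexx _) _.
- apply: measurable_sum => l; apply: measurable_funM;
    exact: (@noise_terms_measurable k l _ Om (fun i o => (Z i o).1)).
- by move=> o; exact: dot_ge0.
- apply: mean_leD; first exact: mean_leZ.
  by apply: mean_leZ => //; rewrite mulr_ge0// divr_ge0 ?ltW.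
Qed.

Let mean_noise : mean_le nu
  (fun o => \sum_l (\sum_k noise fstar (Z k o) * a k (fun i => (Z i o).1) l 0) ^+ 2)
  (sigma ^+ 2 * (N%:R * (4 * q%:R + kap / lam * n%:R * tau))).
Proof.
have ms l : measurable_fun setT
    (fun o => (\sum_k noise fstar (Z k o) * a k (fun i => (Z i o).1) l 0) ^+ 2).
  apply: measurable_funX; apply: measurable_sum => k; apply: measurable_funM.
    exact: (measurableT_comp (noise_measurable hmean)).
  exact: (@noise_terms_measurable k l _ Om (fun i o => (Z i o).1)).
have ma l : measurable_fun setT
    (fun o => sigma ^+ 2 * \sum_k a k (fun i => (Z i o).1) l 0 ^+ 2).
  apply: measurable_funM => //; apply: measurable_sum => k; apply: measurable_funX.
  exact: (@noise_terms_measurable k l _ Om (fun i o => (Z i o).1)).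
have ma0 l o : 0 <= sigma ^+ 2 * \sum_k a k (fun i => (Z i o).1) l 0 ^+ 2.
  by rewrite mulr_ge0 ?sqr_ge0// sumr_ge0// => k _; exact: sqr_ge0.
have [mS S0 Sle] : mean_le nu (fun o => sigma ^+ 2 *
    \sum_k dot (a k (fun i => (Z i o).1)) (a k (fun i => (Z i o).1)))
    (sigma ^+ 2 * (N%:R * (4 * q%:R + kap / lam * n%:R * tau))).
  apply: mean_leZ; first exact: sqr_ge0.
  have -> : N%:R * (4 * q%:R + kap / lam * n%:R * tau) =
      \sum_(k < N) (4 * q%:R + kap / lam * n%:R * tau).
    by rewrite sumr_const card_ord mulr_natl.
  by apply: mean_le_sum => k; exact: mean_a.
split.
- exact: measurable_sum.
- by move=> o; apply: sumr_ge0 => l _; exact: sqr_ge0.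
- apply: le_trans Sle.
  under eq_integral do rewrite -sumEFin.
  rewrite ge0_integral_sum//; last first.
  + by move=> l o _; rewrite lee_fin sqr_ge0.
  + by move=> l; exact/measurable_EFinP.
  have -> : (\int[nu]_o (sigma ^+ 2 * \sum_k dot (a k (fun i => (Z i o).1))
      (a k (fun i => (Z i o).1)))%:E =
      \sum_l \int[nu]_o (sigma ^+ 2 * \sum_k a k (fun i => (Z i o).1) l 0 ^+ 2)%:E)%E.
    rewrite -ge0_integral_sum//.
    - apply: eq_integral => o _; rewrite sumEFin -mulr_sumr; congr (_ * _)%:E.
      by rewrite exchange_big.
    - by move=> l; exact/measurable_EFinP.
    - by move=> l o _; rewrite lee_fin.
  apply: lee_sum => l _.
  apply: (integral_noise_sum_le mZ indepZ hmean hvar hv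
    (a := fun k x => a k x l 0) (B := 1 + kap / lam * n%:R)) => // k x.
  have h : (a k x l 0) ^+ 2 <= kap / lam * n%:R.
    apply: le_trans (a_bound k x); rewrite /dot (bigD1 l)//= -expr2 lerDl.
    by apply: sumr_ge0 => i _; exact: sqr_ge0.
  have := sqr_ge0 (`|a k x l 0| - 1).
  rewrite sqrrB1 real_normK ?num_real//.
  have := normr_ge0 (a k x l 0); lra.
Qed.

(** The first term is the noise, the second the bias; [tau] bounds the
    probability of the bad event.  The majorant [U] is explicit and measurable, which is not known for the
    risk itself. *)
Lemma average_error_mean_le : exists2 U : ('I_N -> X * R) -> R,
  forall z, dot (average_error z) (average_error z) <= U z &
  mean_le nu (fun o => U (fun k => Z k o))
   (2 * N%:R ^- 2 * (sigma ^+ 2 * (N%:R * (4 * q%:R + kap / lam * n%:R * tau))) +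
    2 * m%:R^-1 * (m%:R * ((4 * lam ^+ 2 + kap ^+ 2 * tau) * dot bvec bvec))).
Proof.
exists upper; first exact: average_error_le.
apply: mean_leD.
  by apply: mean_leZ mean_noise; rewrite mulr_ge0// invr_ge0 exprn_ge0.
apply: mean_leZ; first by rewrite mulr_ge0// invr_ge0.
have -> : m%:R * ((4 * lam ^+ 2 + kap ^+ 2 * tau) * dot bvec bvec) =
    \sum_(i < m) (4 * lam ^+ 2 + kap ^+ 2 * tau) * dot bvec bvec.
  by rewrite sumr_const card_ord mulr_natl.
apply: mean_le_sum => i.
rewrite (_ : (fun o => _) = (fun o => dot bvec bvec *
  (4 * lam ^+ 2 + kap ^+ 2 * bad i (fun k => (Z k o).1)))); last first.
  by apply/funext => o; rewrite mulrC.
rewrite (mulrC _ (dot bvec bvec)); apply: mean_leZ; first exact: dot_ge0.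
apply: mean_leD; first by apply: mean_le_cst; rewrite mulr_ge0 ?sqr_ge0.
by apply: mean_leZ => //; exact: sqr_ge0.
Qed.

End Risk.

(** * Orthonormal eigenfunctions and truncation *)

Section Orthonormal.
Context {d : measure_display} {X : measurableType d} {R : realType} {q : nat}.
Variables (P : probability (X * R)%type R) (phi : 'I_q -> X -> R).
Hypotheses (phiL2 : forall l, phi l \in Lfun (marginal P) 2%:E)
  (phi_on : forall l l',
    ('E_(marginal P)[fun x => (phi l x * phi l' x)%R] = ((l == l')%:R)%:E)%E).

Lemma orthonormal_measurable l : measurable_fun setT (phi l).
Proof. by have /andP[/set_mem] := phiL2 l. Qed.

Lemma orthonormal_integrable l l' :
  (marginal P).-integrable setT (fun x => (phi l x * phi l' x)%:E).
Proof. by apply/Lfun1_integrable; exact: Lfun2_mul_Lfun1. Qed.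

Lemma integral_orthonormal l l' :
  (\int[marginal P]_x (phi l x * phi l' x)%:E = ((l == l')%:R)%:E)%E.
Proof. by rewrite -phi_on unlock. Qed.

Lemma integral_orthonormal_joint l l' :
  (\int[P]_z (phi l z.1 * phi l' z.1)%:E = ((l == l')%:R)%:E)%E.
Proof.
rewrite -integral_orthonormal.
by rewrite (integral_marginal measurableT (orthonormal_integrable l l')) preimage_setT.
Qed.

Lemma Lnorm2_orthonormal (delta : 'cV[R]_q) :
  (Lnorm (marginal P) 2%:E (EFin \o (fun x => \sum_l delta l 0 * phi l x)%R) ^+ 2 =
   (dot delta delta)%:E)%E.
Proof.
have int2 : (\int[marginal P]_x ((\sum_l delta l 0 * phi l x) ^+ 2)%:E =
    (dot delta delta)%:E)%E.
  pose c l l' := delta l 0 * delta l' 0.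
  have ic l l' : (marginal P).-integrable setT
      (fun x => ((c l l')%:E * (phi l x * phi l' x)%:E)%E).
    exact: integrableZl (orthonormal_integrable l l').
  transitivity (\int[marginal P]_x
      (\sum_l \sum_l' (c l l')%:E * (phi l x * phi l' x)%:E))%E.
    apply: eq_integral => x _; rewrite expr2 mulr_suml -sumEFin.
    apply: eq_bigr => l _; rewrite mulr_sumr -sumEFin; apply: eq_bigr => l' _.
    by rewrite -EFinM /c; congr _%:E; ring.
  rewrite integral_sum//; last by move=> l; exact: integrable_sum.
  rewrite /dot -sumEFin; apply: eq_bigr => l _.
  rewrite integral_sum// (bigD1 l)//= big1 ?adde0.
    rewrite integralZl ?integral_orthonormal ?eqxx ?mule1//.
    exact: orthonormal_integrable.
  move=> l' /negbTE ll'; rewrite integralZl ?integral_orthonormal//.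
    by rewrite eq_sym ll' mule0.
  exact: orthonormal_integrable.
have -> : (Lnorm (marginal P) 2%:E (EFin \o (fun x => \sum_l delta l 0 * phi l x)%R) =
    (Num.sqrt (dot delta delta))%:E)%E.
  rewrite unlock /Lnorm -powR12_sqrt ?dot_ge0// -poweR_EFin -int2.
  congr (_ `^ _)%E; apply: eq_integral => x _.
  by rewrite [(EFin \o _) x]/= abse_EFin poweR_EFin powR_mulrn// real_normK ?num_real.
by rewrite expe2 -EFinM -expr2 sqr_sqrtr ?dot_ge0.
Qed.

(** A weight making the products of eigenfunctions bounded by [b] while keeping
    their means [M] close to the identity matrix. *)
Definition truncation (r : nat) (w : X -> R) (M : 'I_q -> 'I_q -> R) (b : R) : Prop :=
  [/\ measurable_fun setT w, forall x, 0 <= w x <= 1,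
      forall l l' x, `|w x * phi l x * phi l' x| <= b &
      [/\ forall l l',
            (\int[P]_z (w z.1 * phi l z.1 * phi l' z.1)%:E = (M l l')%:E)%E,
          forall l l', `|M l l' - (l == l')%:R| <= (4 * r%:R)^-1 & 1 <= b]].

Lemma truncation_bounded (r : nat) (rho : R) : 1 <= rho ^+ 2 ->
  (forall l x, `|phi l x| <= rho) ->
  truncation r (fun=> 1) (fun l l' => (l == l')%:R) (rho ^+ 2).
Proof.
move=> rho1 hrho; split => //.
- by move=> x; rewrite ler01 lexx.
- move=> l l' x; rewrite mul1r normrM expr2.
  by apply: ler_pM.
- split=> //.
  + move=> l l'; rewrite -integral_orthonormal_joint.
    by apply: eq_integral => z _; rewrite mul1r.
  + by move=> l l'; rewrite subrr normr0 invr_ge0 mulr_ge0.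
Qed.

(** Weighting by [B / (B + |phi|^2)] makes the products bounded by [B]; as [B]
    grows the weighted second moments converge to the identity by dominated
    convergence. *)
Lemma truncation_exists (r : nat) : (0 < r)%N -> exists w M b, truncation r w M b.
Proof.
move=> r0; pose s x := \sum_l phi l x ^+ 2.
have s0 x : 0 <= s x by apply: sumr_ge0 => l _; exact: sqr_ge0.
pose w n x : R := n.+1%:R / (n.+1%:R + s x).
have den n x : 0 < n.+1%:R + s x by rewrite ltr_pwDl.
have mphi := orthonormal_measurable.
have mw n : measurable_fun setT (w n).
  apply: measurable_funM => //; apply: measurable_funV; apply: measurable_funD => //.
  by apply: measurable_sum => l; exact: measurable_funX.
have w01 n x : 0 <= w n x <= 1.
  apply/andP; split; first by rewrite divr_ge0// ltW.
  by rewrite ler_pdivrMr// mul1r lerDl.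
have prods l l' x : `|phi l x * phi l' x| <= s x.
  have h k : phi k x ^+ 2 <= s x.
    by rewrite /s (bigD1 k)//= lerDl sumr_ge0// => i _; exact: sqr_ge0.
  rewrite normrM; have := h l; have := h l'.
  have := sqr_ge0 (`|phi l x| - `|phi l' x|).
  by rewrite sqrrB !real_normK ?num_real//; lra.
have gb n l l' x : `|w n x * phi l x * phi l' x| <= n.+1%:R.
  rewrite -mulrA normrM ger0_norm; last by have /andP[] := w01 n x.
  apply: (@le_trans _ _ (w n x * s x)).
    by apply: ler_wpM2l => //; have /andP[] := w01 n x.
  rewrite /w -mulrA (mulrC _ (s x)) mulrA ler_pdivrMr// ler_wpM2l//.
  by rewrite lerDr.
pose I n l l' := (\int[P]_z (w n z.1 * phi l z.1 * phi l' z.1)%:E)%E.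
have mprod n l l' : measurable_fun setT (fun z : X * R => w n z.1 * phi l z.1 * phi l' z.1).
  apply: measurable_funM; last exact: (measurableT_comp (mphi l')).
  apply: measurable_funM; first exact: (measurableT_comp (mw n)).
  exact: (measurableT_comp (mphi l)).
have Ifin n l l' : I n l l' \is a fin_num.
  apply: integrable_fin_num => //.
  by apply: (bounded_integrable P (b := n.+1%:R)) => //.
have wcvg x : w n x @[n --> \oo] --> (1 : R).
  have -> : (fun n => w n x) = (fun n => (1 + s x * n.+1%:R^-1)^-1).
    apply/funext => n; rewrite /w; have := den n x.
    have : 0 < n.+1%:R :> R by [].
    move: (n.+1%:R) => a a0 as0; field.
    by rewrite !gt_eqF.
  have h : (1 + s x * n.+1%:R^-1 : R) @[n --> \oo] --> (1 + s x * 0 : R).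
    by apply: cvgD; [exact: cvg_cst|apply: cvgMr; exact: cvg_harmonic].
  rewrite mulr0 addr0 in h.
  by rewrite -[X in _ --> X]invr1; apply: cvgV.
have pcvg l l' x : w n x * phi l x * phi l' x @[n --> \oo] --> phi l x * phi l' x.
  rewrite -[X in _ --> X]mul1r mulrA.
  by do 2 apply: cvgMl.
have Icvg l l' : I n l l' @[n --> \oo] --> ((l == l')%:R : R)%:E.
  rewrite -integral_orthonormal_joint.
  apply: (@dominated_cvg _ _ _ P setT measurableT
    (fun n z => (w n z.1 * phi l z.1 * phi l' z.1)%:E)
    _ (fun z => `|phi l z.1 * phi l' z.1|%:E)) => //.
  - by move=> n; apply/measurable_EFinP.
  - move=> z _; apply: cvg_EFin; first exact: nearW.
    exact: (pcvg l l' z.1).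
  - have := integrable_abse (integrable_marginal (orthonormal_integrable l l')).
    by apply: eq_integrable.
  - move=> n z _; rewrite abse_EFin lee_fin -mulrA normrM ler_piMl//.
    by have /andP[w0 w1] := w01 n z.1; rewrite ger0_norm.
have e0 : 0 < (4 * r%:R)^-1 :> R by rewrite invr_gt0 mulr_gt0 ?ltr0n.
have near1 l l' : \forall n \near \oo, `|fine (I n l l') - (l == l')%:R| <= (4 * r%:R)^-1.
  have h : fine (I n l l') @[n --> \oo] --> ((l == l')%:R : R).
    exact: fine_cvg (Icvg l l').
  move/cvgrPdist_le : h => /(_ _ e0).
  by apply: filterS => n; rewrite distrC.
have [n _ hn] : \forall n \near \oo, forall l l',
    `|fine (I n l l') - (l == l')%:R| <= (4 * r%:R)^-1.
  by apply: filter_forall => l; apply: filter_forall => l'; exact: near1.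
exists (w n), (fun l l' => fine (I n l l')), n.+1%:R; split => //; split.
- by move=> l l'; rewrite fineK.
- by apply: hn => /=.
- by rewrite ler1n.
Qed.

End Orthonormal.

(** [ln y <= y] at [y = N ^ (al / 2)] leaves a spare factor [N ^ (al / 2)] to
    absorb the constants. *)
Lemma ln_le_powR (R : realType) (al D : R) : 0 < al -> 0 < D ->
  exists N0 : nat, forall N : nat, (N0 <= N)%N -> ln N%:R <= D * N%:R `^ al.
Proof.
move=> al0 D0; pose B := 2 / (al * D).
have B0 : 0 < B by rewrite divr_gt0// mulr_gt0.
exists (Num.trunc (B `^ (2 / al))).+1 => N NN.
have N1 : B `^ (2 / al) <= N%:R.
  by apply/ltW/(lt_le_trans (truncnS_gt _)); rewrite ler_nat.
have N0 : 0 < N%:R :> R by rewrite ltr0n; exact: leq_trans NN.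
have y0 : 0 < N%:R `^ (al / 2) :> R by rewrite powR_gt0.
have yB : B <= N%:R `^ (al / 2).
  have -> : B = (B `^ (2 / al)) `^ (al / 2).
    rewrite -powRrM (_ : 2 / al * (al / 2) = 1) ?powRr1 ?ltW//.
    by field; rewrite gt_eqF.
  apply: ge0_ler_powR => //; first by rewrite divr_ge0// ltW.
    by rewrite nnegrE powR_ge0.
  by rewrite nnegrE.
have -> : N%:R `^ al = N%:R `^ (al / 2) * N%:R `^ (al / 2) :> R.
  rewrite -powRD; last by rewrite (gt_eqF N0) implybT.
  by congr (_ `^ _); field.
have := ln_sublinear y0; rewrite ln_powR => /ltW h.
move: (N%:R `^ (al / 2)) => y in y0 yB h *.
rewrite -(ler_pM2l (_ : 0 < al / 2)) ?divr_gt0//; apply: le_trans h _.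
have -> : al / 2 * (D * (y * y)) = B^-1 * y * y.
  by rewrite /B; field; rewrite !gt_eqF.
by rewrite ler_peMl ?(ltW y0)// mulrC ler_pdivlMr// mul1r.
Qed.

(** * The random split *)

(** The integral of a nonnegative function is a supremum over the simple functions
    below it, so it is monotone for arbitrary functions.  The risk is only compared
    with a measurable majorant, the estimates being arbitrary functions of the
    outcome. *)
Lemma le_integral_of_ge0 (d : measure_display) (T : measurableType d)
    (R : realType) (P : {measure set T -> \bar R}) (f g : T -> \bar R) :
  (forall x, (0 <= f x)%E) -> (forall x, (f x <= g x)%E) ->
  (\int[P]_x f x <= \int[P]_x g x)%E.
Proof.
move=> f0 fg; have g0 x : (0 <= g x)%E by exact: le_trans (fg x).
rewrite !ge0_integralE//; apply: le_ereal_sup => _ [h /= hf <-].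
exists h => //= x.
by apply: le_trans (hf x) _; rewrite !patch_setT.
Qed.

Lemma integral_mrestr_ge (d : measure_display) (T : measurableType d)
    (R : realType) (P : {measure set T -> \bar R}) (D : set T) (mD : measurable D)
    (f : T -> \bar R) : measurable_fun setT f -> (forall x, (0 <= f x)%E) ->
  (\int[P]_(x in D) f x <= \int[mrestr P mD]_x f x)%E.
Proof.
move=> mf f0; rewrite (eq_measure_integral (mrestr P mD)); last first.
  by move=> A mA AD; rewrite /= /mrestr setIidl.
by apply: ge0_subset_integral => //.
Qed.

Lemma positive_prefix (R : realType) (mu : nat -> R) (r : nat) :
  (forall i j, (i <= j)%N -> mu j <= mu i) -> (forall j, 0 <= mu j) ->
  (forall j, (r <= j)%N -> mu j = 0) ->
  exists q, [/\ (q <= r)%N, forall j, (j < q)%N -> 0 < mu j &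
                forall j, (q <= j)%N -> mu j = 0].
Proof.
move=> mono mu0; elim: r => [h|r IH h]; first by exists 0%N.
have [mur|mur] := ltP 0 (mu r).
  exists r.+1; split => // j; rewrite ltnS => jr.
  exact: lt_le_trans mur (mono _ _ jr).
have [|q [qr h1 h2]] := IH; last by exists q; split => //; exact: leq_trans qr _.
move=> j; rewrite leq_eqVlt => /orP[/eqP <-|]; last exact: h.
by apply/eqP; rewrite eq_le mur mu0.
Qed.

Lemma mercer_finite_sum (d : measure_display) (X : measurableType d) (R : realType)
    (Q : probability X R) (K : X -> X -> R) (mu : nat -> R) (phi : nat -> X -> R)
    (q : nat) : mercer Q K mu phi -> (forall j, (q <= j)%N -> mu j = 0) ->
  forall x y, K x y = \sum_(l < q) mu l * phi l x * phi l y.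
Proof.
move=> [_ _ _ hK] muq x y.
pose S n := \sum_(j < n) mu j * phi j x * phi j y.
have E n : S (n + q)%N = S q.
  elim: n => [//|n IH]; rewrite addSn /S big_ord_recr /= -/(S _) IH.
  by rewrite muq ?leq_addl// !mul0r addr0.
have hS : S n @[n --> \oo] --> S q.
  rewrite -(cvg_shiftn q).
  rewrite (_ : [sequence _]_n = (fun=> S q)); first exact: cvg_cst.
  by apply/funext => n; exact: E.
by rewrite -(cvg_lim _ (hK x y))//; exact: cvg_lim hS.
Qed.

Section SplitRisk.
Context {d : measure_display} {X : measurableType d} {R : realType}.
Variables (P : probability (X * R)%type R)
  (K : X -> X -> R) (H : set (X -> R)) (ip : (X -> R) -> (X -> R) -> R)
  (q r : nat) (mu : 'I_q -> R) (phi : 'I_q -> X -> R) (beta : 'I_q -> R)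
  (kap : R) (fstar v : X -> R) (sigma : R)
  (w : X -> R) (M : 'I_q -> 'I_q -> R) (b : R).
Hypotheses (rkhs : is_rkhs K H ip)
  (K_sum : forall x y, K x y = \sum_l mu l * phi l x * phi l y)
  (mu_gt0 : forall l, 0 < mu l) (mu_le : forall l, mu l <= kap) (kap_gt0 : 0 < kap)
  (phiL2 : forall l, phi l \in Lfun (marginal P) 2%:E)
  (phi_on : forall l l',
    ('E_(marginal P)[fun x => (phi l x * phi l' x)%R] = ((l == l')%:R)%:E)%E)
  (fstarE : forall x, fstar x = \sum_l mu l * beta l * phi l x)
  (qr : (q <= r)%N) (r_gt0 : (0 < r)%N) (htrunc : truncation P phi r w M b)
  (hmean : is_cond_exp P snd fstar) (sigma_gt0 : 0 < sigma)
  (hvar : is_cond_exp P (fun z => (z.2 - fstar z.1) ^+ 2) v)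
  (hv : forall x, v x <= sigma ^+ 2).

Let bvec : 'cV[R]_q := \col_l beta l.

(** The first summand comes from the noise, the second from the bias. *)
Definition risk_constant : R :=
  2 * (4 + 2 * kap) +
  2 * dot bvec bvec * r%:R * (4 + 2 * kap ^+ 2) / sigma ^+ 2.

Section Split.
Variables (N m n : nat).
Hypotheses (N_gt0 : (0 < N)%N) (m_gt0 : (0 < m)%N) (Nnm : N = (n * m)%N)
  (rate : 2 * ln N%:R <= bad_rate b r * n%:R).

Let bound : R := risk_constant * (sigma ^+ 2 * r%:R / N%:R).

Let N0 : 0 < N%:R :> R. Proof. by rewrite ltr0n. Qed.
Let r0 : 0 < r%:R :> R. Proof. by rewrite ltr0n. Qed.
Let nN : n%:R <= N%:R :> R.
Proof. by rewrite ler_nat Nnm leq_pmulr. Qed.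

Let tau : R := 2 * q%:R ^+ 2 * expR (- (bad_rate b r * n%:R)).

Let tau_le : tau <= 2 * (r%:R / N%:R) ^+ 2.
Proof.
have e : expR (- (bad_rate b r * n%:R)) <= N%:R ^- 2.
  apply: (@le_trans _ _ (expR (- (2 * ln N%:R)))).
    by rewrite ler_expR lerN2.
  by rewrite expRN -[2 * _]/(2%:R * _) expRM_natl lnK ?posrE.
have h : 2 * q%:R ^+ 2 <= 2 * r%:R ^+ 2 :> R.
  by rewrite ler_pM2l// lerXn2r ?nnegrE// ler_nat.
have h0 : 0 <= 2 * q%:R ^+ 2 :> R by apply: mulr_ge0 => //; exact: exprn_ge0.
have -> : 2 * (r%:R / N%:R) ^+ 2 = 2 * r%:R ^+ 2 * N%:R ^- 2 :> R.
  by rewrite expr_div_n mulrA.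
exact: ler_pM h0 (expR_ge0 _) h e.
Qed.

Let lam : R := r%:R / N%:R.

Let bound_le :
  2 * N%:R ^- 2 * (sigma ^+ 2 * (N%:R * (4 * q%:R + kap / lam * n%:R * tau))) +
  2 * m%:R^-1 * (m%:R * ((4 * lam ^+ 2 + kap ^+ 2 * tau) * dot bvec bvec)) <= bound.
Proof.
have tau0 : 0 <= tau by rewrite mulr_ge0 ?expR_ge0// mulr_ge0 ?exprn_ge0.
have qrR : q%:R <= r%:R :> R by rewrite ler_nat.
have m0 : 0 < m%:R :> R by rewrite ltr0n.
have s0 : 0 < sigma ^+ 2 by rewrite exprn_gt0.
have b0 := dot_ge0 bvec.
have N1 : 1 <= N%:R :> R by rewrite ler1n.
have h1 : 4 * q%:R + kap / lam * n%:R * tau <= r%:R * (4 + 2 * kap).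
  have : kap / lam * n%:R * tau <= kap / lam * N%:R * (2 * lam ^+ 2).
    apply: ler_pM => //; first by rewrite mulr_ge0// divr_ge0 ?ltW// divr_gt0.
    by rewrite ler_wpM2l// divr_ge0 ?ltW// divr_gt0.
  have -> : kap / lam * N%:R * (2 * lam ^+ 2) = 2 * kap * r%:R.
    by rewrite /lam; field; rewrite !gt_eqF.
  lra.
have h2 : 4 * lam ^+ 2 + kap ^+ 2 * tau <= (4 + 2 * kap ^+ 2) * (r%:R ^+ 2 / N%:R).
  apply: (@le_trans _ _ ((4 + 2 * kap ^+ 2) * lam ^+ 2)).
    have : kap ^+ 2 * tau <= kap ^+ 2 * (2 * lam ^+ 2) by rewrite ler_wpM2l ?sqr_ge0.
    lra.
  have k0 : 0 <= 4 + 2 * kap ^+ 2 by have := sqr_ge0 kap; lra.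
  rewrite ler_wpM2l// /lam expr_div_n ler_wpM2l ?sqr_ge0// lef_pV2 ?posrE ?exprn_gt0//.
  by rewrite expr2 ler_peMl// ltW.
rewrite (_ : 2 * N%:R ^- 2 * _ = 2 * sigma ^+ 2 / N%:R *
  (4 * q%:R + kap / lam * n%:R * tau)); last by field; rewrite !gt_eqF// divr_gt0.
rewrite (_ : 2 * m%:R^-1 * _ = 2 * dot bvec bvec *
  (4 * lam ^+ 2 + kap ^+ 2 * tau)); last by field; rewrite !gt_eqF.
have -> : bound = 2 * sigma ^+ 2 / N%:R * (r%:R * (4 + 2 * kap)) +
    2 * dot bvec bvec * ((4 + 2 * kap ^+ 2) * (r%:R ^+ 2 / N%:R)).
  by rewrite /bound /risk_constant; field; rewrite !gt_eqF.
apply: lerD; first by rewrite ler_pM2l// divr_gt0// mulr_gt0.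
by rewrite ler_wpM2l// mulr_ge0.
Qed.

Let risk_constant_ge0 : 0 <= risk_constant.
Proof.
have b0 := dot_ge0 bvec; have k2 := sqr_ge0 kap.
rewrite addr_ge0//; first by rewrite mulr_ge0// addr_ge0// mulr_ge0// ltW.
rewrite divr_ge0 ?sqr_ge0// !mulr_ge0//.
by rewrite addr_ge0// mulr_ge0.
Qed.

Context {dO : measure_display} {Om : measurableType dO}.
Variables (Pr : probability Om R) (Z : 'I_N -> Om -> X * R)
  (s : Om -> {ffun 'I_N -> 'I_m}) (fhat : 'I_m -> Om -> X -> R).
Hypotheses (hsample : is_split_sample P Pr Z s)
  (hfhat : forall i o, is_krr_estimate H ip (r%:R / N%:R) (block (s o) i)
                 (fun j => Z j o) (fhat i o)).

Let risk (o : Om) : \bar R :=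
  (Lnorm (marginal P) 2%:E
    (EFin \o (m%:R^-1 *: \sum_(i < m) fhat i o - fstar)%R) ^+ 2)%E.

Let imu l := (mu l)^-1.
Let imu_ge l : kap^-1 <= imu l.
Proof. by rewrite lef_pV2 ?posrE. Qed.

Let risk_eq o (t : {ffun 'I_N -> 'I_m}) : s o = t ->
  risk o = (dot (average_error phi imu beta fstar r t (fun k => Z k o))
    (average_error phi imu beta fstar r t (fun k => Z k o)))%:E.
Proof.
move=> st; rewrite -(Lnorm2_orthonormal phiL2 phi_on) /risk.
congr ((Lnorm _ _ (EFin \o _)) ^+ 2)%E; apply/funext => x.
have lam0 : 0 < r%:R / N%:R :> R by rewrite divr_gt0.
have err i : fhat i o x - fstar x =
    \sum_l block_error phi imu beta fstar r t (fun k => Z k o) i l 0 * phi l x.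
  have h := hfhat i o; rewrite st in h.
  exact: (krr_error rkhs K_sum lam0 h mu_gt0 fstarE
    (ridge_unitmx _ _ lam0 kap_gt0 imu_ge)).
have m0 : m%:R != 0 :> R by rewrite pnatr_eq0 -lt0n.
transitivity (m%:R^-1 * \sum_(i < m) (fhat i o x - fstar x)).
  have sumC : \sum_(i < m) fstar x = m%:R * fstar x.
    by rewrite sumr_const card_ord mulr_natl.
  rewrite sumrB sumC mulrBr mulKf//.
  rewrite -[LHS]/((m%:R^-1 *: \sum_(i < m) fhat i o) x - fstar x).
  by congr (_ - _); rewrite -[LHS]/(m%:R^-1 * _) fct_sumE.
rewrite (eq_bigr _ (fun i _ => err i)) exchange_big mulr_sumr /=.
apply: eq_bigr => l _; rewrite /average_error mxE summxE -mulrA mulr_suml.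
by [].
Qed.

Let msplit t : measurable [set o | s o = t].
Proof. exact: split_measurable hsample t. Qed.

(* Splits which are not even have probability 0, so that +oo is a majorant. *)
Let majorant (t : {ffun 'I_N -> 'I_m}) : exists G : Om -> \bar R,
  [/\ measurable_fun setT G, forall o, (0 <= G o)%E,
      forall o, s o = t -> (risk o <= G o)%E &
      (\int[Pr]_(o in [set o | s o = t]) G o <=
        bound%:E * Pr [set o | s o = t])%E].
Proof.
have [tE|tE] := boolP (t \in even_splits N m); last first.
  exists (cst +oo%E); split => //.
  - by move=> o; exact: leey.
  - by move=> o _; exact: leey.
  - rewrite integral_cst//.
    have E := split_uniform hsample t; rewrite (negbTE tE) in E.
    by rewrite E mule0 [X in (+oo * X)%E]E mule0.
have blockn i : #|block t i| = n.
  move: tE; rewrite inE => /forallP /(_ i) /eqP ->.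
  by rewrite Nnm mulnK.
pose nu : {finite_measure set Om -> \bar R} := mrestr Pr (msplit t).
have [mw w01 gb [gM M_near b1]] := htrunc.
have nuT : nu setT = Pr [set o | s o = t] by rewrite /nu /= /mrestr setTI.
have indepZ : forall B : 'I_N -> set (X * R), (forall k, measurable (B k)) ->
    nu [set o | forall k, B k (Z k o)] = (nu setT * \prod_(k < N) P (B k))%E.
  move=> B mB; rewrite nuT -(sample_iid hsample mB) -(split_independent hsample)//.
  by rewrite /nu /= /mrestr; congr (Pr _); apply/seteqP; split=> o [].
have mphi := orthonormal_measurable phiL2.
have phi2 l : (\int[P]_z (phi l z.1 ^+ 2)%:E <= 1)%E.
  by have := integral_orthonormal_joint phiL2 phi_on l l; rewrite eqxx => <-.
have [U hU [mU U0 Ule]] := average_error_mean_le beta mphi phi2 mw w01 gb gM M_near b1 qr r_gt0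
  kap_gt0 imu_ge hmean hvar hv (sample_measurable hsample) indepZ
  N_gt0 m_gt0 Nnm blockn.
exists (fun o => (U (fun k => Z k o))%:E); split => //.
- exact/measurable_EFinP.
- by move=> o st; rewrite (risk_eq st) lee_fin; exact: hU.
- have mUE : measurable_fun setT (fun o => (U (fun k => Z k o))%:E).
    exact/measurable_EFinP.
  apply: le_trans (integral_mrestr_ge Pr (msplit t) mUE _) _ => //.
  apply: le_trans Ule _; rewrite -nuT; exact: lee_wpmul2r.
Qed.

Lemma split_risk_le : (\int[Pr]_o risk o <= bound%:E)%E.
Proof.
have [G hG] := choice majorant.
have bound0 : 0 <= bound by rewrite mulr_ge0// divr_ge0 ?ltW// mulr_gt0// exprn_gt0.
have mGt t : measurable_fun setT (G t \_ [set o | s o = t]).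
  by have [mG _ _ _] := hG t; apply/(measurable_restrictT _ (msplit t)); exact: measurable_funTS.
have G0 t o : (0 <= (G t \_ [set o | s o = t]) o)%E.
  by apply: erestrict_ge0 => o' _; have [_ + _ _] := hG t; apply.
apply: (@le_trans _ _ (\int[Pr]_o (\sum_t (G t \_ [set o | s o = t]) o))%E).
  apply: le_integral_of_ge0 => o; first exact: sqre_ge0.
  rewrite (bigD1 (s o))//= patchE mem_set//.
  have [_ _ hle _] := hG (s o); rewrite -[leLHS]adde0.
  by apply: leeD; [exact: hle|apply: sume_ge0 => t _; exact: G0].
rewrite ge0_integral_sum//.
apply: (@le_trans _ _ (\sum_t bound%:E * Pr [set o | s o = t])%E).
  apply: lee_sum => t _; rewrite -integral_mkcond.
  by have [_ _ _] := hG t.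
rewrite -ge0_sume_distrr; last by move=> t _; exact: measure_ge0.
rewrite -[leRHS]mule1; apply: lee_wpmul2l; first by rewrite lee_fin.
under eq_bigr do rewrite (split_uniform hsample).
rewrite sumEFin lee_fin -big_mkcond sumr_const /=.
have [->|e0] := eqVneq #|even_splits N m| 0%N; first by rewrite mulr0n.
by rewrite -[_ *+ _]mulr_natl mulfV// pnatr_eq0.
Qed.

End Split.
End SplitRisk.

(** * Block sizes *)

Lemma bounded_rate (R : realType) (c rho : R) (r N m n : nat) :
  1024 * c <= 1 -> 1 <= rho ^+ 2 -> (0 < r)%N -> (2 <= N)%N -> (0 < m)%N ->
  N = (n * m)%N ->
  m%:R <= c * (N%:R / (r%:R ^+ 2 * rho ^+ 4 * ln N%:R)) ->
  2 * ln N%:R <= bad_rate (rho ^+ 2) r * n%:R.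
Proof.
move=> hc rho1 r0 N2 m0 Nnm.
have r0R : 0 < r%:R :> R by rewrite ltr0n.
have m0R : 0 < m%:R :> R by rewrite ltr0n.
have rho0 : 0 < rho ^+ 2 by exact: lt_le_trans rho1.
have lnN : 0 < ln N%:R :> R by rewrite ln_gt0// ltr1n.
have rho4 : rho ^+ 4 = (rho ^+ 2) ^+ 2 by rewrite -exprM.
set D := r%:R ^+ 2 * rho ^+ 4 * ln N%:R.
have D0 : 0 < D.
  by rewrite /D rho4; apply: mulr_gt0 => //; apply: mulr_gt0; exact: exprn_gt0.
rewrite mulrA ler_pdivlMr// => hm.
have h : D <= n%:R * c.
  rewrite -(ler_pM2l m0R); apply: le_trans hm _.
  by rewrite {1}Nnm natrM le_eqVlt; apply/orP; left; apply/eqP; ring.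
have E : bad_rate (rho ^+ 2) r * n%:R =
    n%:R / (512 * r%:R ^+ 2 * (rho ^+ 2) ^+ 2) by rewrite /bad_rate mulrC.
rewrite E ler_pdivlMr; last first.
  apply: mulr_gt0; last exact: exprn_gt0.
  by apply: mulr_gt0; [rewrite ltr0n|exact: exprn_gt0].
have -> : 2 * ln N%:R * (512 * r%:R ^+ 2 * (rho ^+ 2) ^+ 2) = 1024 * D.
  by rewrite /D rho4; ring.
have h' : 1024 * D <= 1024 * (n%:R * c) by rewrite (ler_pM2l (ltr0n R 1024)).
apply: le_trans h' _; rewrite mulrCA -[leRHS]mulr1.
by rewrite ler_wpM2l.
Qed.

(** For [e = 2 / (k - 2)] the exponent [1 - e] is [(k - 4) / (k - 2)], and the
    condition on [m] says that [n] is at least a multiple of [N ^ e]. *)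
Lemma moment_rate (R : realType) (c e D b : R) (r : nat) :
  0 < c -> 0 < e -> 0 <= D -> 1 <= b -> (0 < r)%N ->
  exists N0 : nat, forall N m n : nat, (N0 <= N)%N -> (0 < m)%N ->
    N = (n * m)%N -> m%:R <= c * (N%:R `^ (1 - e) / D) ->
    2 * ln N%:R <= bad_rate b r * n%:R.
Proof.
move=> c0 e0 D0 b1 r0.
have r0R : 0 < r%:R :> R by rewrite ltr0n.
have b0 : 0 < b by exact: lt_le_trans b1.
have rate0 : 0 < bad_rate b r.
  rewrite /bad_rate invr_gt0; apply: mulr_gt0; last exact: exprn_gt0.
  by apply: mulr_gt0; [rewrite ltr0n|exact: exprn_gt0].
have [D00|Dn0] := eqVneq D 0.
  exists 0%N => N m n _ m0 _; rewrite D00 invr0 !mulr0 => /le_gtF.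
  by rewrite ltr0n m0.
have Dgt0 : 0 < D by rewrite lt_def Dn0.
have k0 : 0 < bad_rate b r * (D / c) / 2 by rewrite !mulr_gt0// invr_gt0.
have [N0 hN0] := ln_le_powR e0 k0.
exists (maxn N0 1) => N m n; rewrite geq_max => /andP[NN N1] m0 Nnm hm.
have NR : 0 < N%:R :> R by rewrite ltr0n.
have m0R : 0 < m%:R :> R by rewrite ltr0n.
have Ne : 0 < N%:R `^ e :> R by rewrite powR_gt0.
have nlow : D / c * N%:R `^ e <= n%:R.
  have split1 : N%:R `^ (1 - e) * N%:R `^ e = N%:R :> R.
    rewrite -powRD; last by rewrite (gt_eqF NR) implybT.
    by rewrite subrK powRr1 ?ltW.
  have h : m%:R * D <= c * N%:R `^ (1 - e) by rewrite -ler_pdivlMr// -mulrA.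
  have h2 : m%:R * (D * N%:R `^ e) <= m%:R * (c * n%:R).
    have -> : m%:R * (c * n%:R) = c * N%:R `^ (1 - e) * N%:R `^ e :> R.
      by rewrite -mulrA split1 Nnm natrM; ring.
    by rewrite mulrA ler_pM2r.
  rewrite ler_pM2l// in h2.
  by rewrite mulrAC ler_pdivrMr// (mulrC n%:R).
have := hN0 N NN; rewrite -(ler_pM2l (ltr0n R 2)) => /le_trans; apply.
have -> : 2 * (bad_rate b r * (D / c) / 2 * N%:R `^ e) =
  bad_rate b r * (D / c * N%:R `^ e).
  by move: (bad_rate b r) => B; field; rewrite gt_eqF.
by rewrite ler_pM2l.
Qed.

Theorem corollary1 (R : realType) :
  exists c : R, 0 < c /\
  forall (d : measure_display) (X : measurableType d)
    (P : probability (X * R)%type R)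
    (K : X -> X -> R) (H : set (X -> R)) (ip : (X -> R) -> (X -> R) -> R)
    (mu : nat -> R) (phi : nat -> X -> R)
    (r : nat) (fstar : X -> R) (sigma : R) (mmax : nat -> R),
  psd_kernel K ->
  is_rkhs K H ip ->
  (forall f, H f -> f \in Lfun (marginal P) 2%:E) ->
  mercer (marginal P) K mu phi ->
  (0 < r)%N ->
  (forall j, (r <= j)%N -> mu j = 0) ->
  is_cond_exp P snd fstar ->
  H fstar ->
  0 < sigma ->
  (exists2 v : X -> R,
     is_cond_exp P (fun z => (z.2 - fstar z.1) ^+ 2) v &
     forall x, v x <= sigma ^+ 2) ->
  (exists k rho : R,
     [/\ 2 < k, 0 <= rho, (1 < r)%N,
       forall j, ('E_(marginal P)[fun x => (`|phi j x| `^ (2 * k))%R] <=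
                  (rho `^ (2 * k))%:E)%E &
       forall N : nat, mmax N =
         c * (N%:R `^ ((k - 4) / (k - 2)) /
              (r%:R ^+ 2 * rho `^ (4 * k / (k - 2)) *
               ln r%:R `^ (k / (k - 2))))]) \/
  (exists rho : R,
     (forall j x, `|phi j x| <= rho) /\
     (forall N : nat, mmax N =
        c * (N%:R / (r%:R ^+ 2 * rho ^+ 4 * ln N%:R)))) ->
  exists (C : R) (N0 : nat), forall N m : nat,
    (N0 <= N)%N -> (0 < m)%N -> (m %| N)%N -> m%:R <= mmax N ->
  forall (dO : measure_display) (Om : measurableType dO)
    (Pr : probability Om R) (Z : 'I_N -> Om -> X * R)
    (s : Om -> {ffun 'I_N -> 'I_m}) (fhat : 'I_m -> Om -> X -> R),
  is_split_sample P Pr Z s ->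
  (forall i w, is_krr_estimate H ip (r%:R / N%:R) (block (s w) i)
                 (fun j => Z j w) (fhat i w)) ->
  let fbar w := m%:R^-1 *: \sum_(i < m) fhat i w in
  (\int[Pr]_w (Lnorm (marginal P) 2%:E (EFin \o (fbar w - fstar)%R) ^+ 2)
     <= (C * (sigma ^+ 2 * r%:R / N%:R))%R%:E)%E.
Proof.
(* The bad event has probability of order exp (- n / (512 r^2 b^2)), which has to
   be at most N^-2. *)
pose c : R := 1024^-1.
have c0 : 0 < c by rewrite invr_gt0 ltr0n.
have n0 : 1024 != 0 :> R by rewrite pnatr_eq0.
have hc : 1024 * c <= 1 by rewrite /c (mulfV n0).
exists c; split => //; move: c c0 hc => c c0 hc.
move=> d X P K H ip mu phi r fstar sigma mmax _ rkhs _ hmercer r0 mur hmean Hf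
  sigma0 [v hvar hv] regime.
have [mono mu0 [phiL2 phi_on _] _] := hmercer.
have [q [qr muq_gt0 muq]] := positive_prefix mono mu0 mur.
have K_sum := mercer_finite_sum hmercer muq.
pose muI (l : 'I_q) := mu l; pose phiI (l : 'I_q) := phi l.
have [beta fstarE] := rkhs_coordinates (mu := muI) (phi := phiI) rkhs K_sum Hf.
pose kap := mu 0%N + 1.
have kap0 : 0 < kap by rewrite ltr_wpDl.
have mu_le l : muI l <= kap by rewrite /kap (le_trans (mono 0%N l _))// lerDl.
have muI_gt0 l : 0 < muI l by exact: muq_gt0.
have L2 l : phiI l \in Lfun (marginal P) 2%:E by exact: phiL2.
have on l l' : ('E_(marginal P)[fun x => (phiI l x * phiI l' x)%R] =
    ((l == l')%:R)%:E)%E by exact: phi_on.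
suff [w [M [b [N0 [htrunc hrate]]]]] : exists w M b N0, truncation P phiI r w M b /\
    forall N m n : nat, (N0 <= N)%N -> (0 < m)%N -> N = (n * m)%N ->
      m%:R <= mmax N -> 2 * ln N%:R <= bad_rate b r * n%:R.
  exists (risk_constant r beta kap sigma), (maxn N0 1) => N m.
  rewrite geq_max => /andP[NN N1] m0 mN mle dO Om Pr Z s fhat hsample hfhat /=.
  have Nnm : N = (N %/ m * m)%N by rewrite divnK.
  exact: (split_risk_le rkhs K_sum muI_gt0 mu_le kap0 L2 on fstarE qr r0 htrunc
    hmean sigma0 hvar hv N1 m0 Nnm (hrate N m _ NN m0 Nnm mle) hsample hfhat).
case: regime => [[k [rho [k2 rho0 r1 _ mmaxE]]]|[rho [hrho mmaxE]]].
- have [w [M [b htrunc]]] := truncation_exists L2 on r0.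
  have b1 : 1 <= b by have [_ _ _ [_ _]] := htrunc.
  have km2 : 0 < k - 2 by rewrite subr_gt0.
  have e0 : 0 < 2 / (k - 2) by rewrite divr_gt0.
  have D0 : 0 <= r%:R ^+ 2 * rho `^ (4 * k / (k - 2)) * ln r%:R `^ (k / (k - 2)) :> R.
    by rewrite !mulr_ge0 ?powR_ge0 ?exprn_ge0.
  have [N0 hN0] := moment_rate c0 e0 D0 b1 r0.
  exists w, M, b, N0; split => // N m n NN m0 Nnm; rewrite mmaxE => hm.
  apply: hN0 NN m0 Nnm _.
  have -> : 1 - 2 / (k - 2) = (k - 4) / (k - 2) by field; rewrite gt_eqF.
  exact: hm.
- have rho1 : 1 <= rho ^+ 2.
    have hsq : (\int[marginal P]_x (phi 0%N x * phi 0%N x)%:E = 1)%E.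
      by have := phi_on 0%N 0%N; rewrite unlock eqxx.
    rewrite -lee_fin -hsq.
    rewrite -[leRHS]mule1 -(@probability_setT _ _ _ (marginal P)) -integral_cst//.
    have mphi : measurable_fun setT (phi 0%N).
      by have /andP[/set_mem] := phiL2 0%N.
    apply: ge0_le_integral => //.
    + by move=> x _; rewrite lee_fin -expr2 sqr_ge0.
    + by apply/measurable_EFinP; exact: measurable_funM.
    + move=> x _; rewrite lee_fin -expr2 -(real_normK (num_real (phi 0%N x))).
      by rewrite lerXn2r ?nnegrE ?(le_trans (normr_ge0 _) (hrho 0%N x)).
  exists (fun=> 1), (fun l l' => (l == l')%:R), (rho ^+ 2), 2%N; split.
    by apply: truncation_bounded => // l x; exact: hrho.
  move=> N m n N2 m0 Nnm; rewrite mmaxE => hm.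
  exact: bounded_rate hc rho1 r0 N2 m0 Nnm hm.
Qed.
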